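(* Let $k$ be a positive integer and $a_k>0$. There exists a constant $B>0$, depending only on $k$ and $a_k$, such that the following holds. Let $Y_k$ be a random variable with probability density function $p_k(x)=b_k\exp(-a_kx^{2k})$, $x\in\mathbb{R}$, where $b_k=\left(\int_{\mathbb{R}}\exp(-a_kx^{2k})\,dx\right)^{-1}$. Let $(W,W')$ be an exchangeable pair of real random variables satisfying $$\mathbb{E}(W'\mid W)=W-\lambda\psi(W)+R,$$ where $0<\lambda<1$ is a constant, $\psi(x)=2ka_kx^{2k-1}$ for $x\in\mathbb{R}$, and $R$ is a random variable. Let $\Delta=W-W'$. Then for any $a>0$, any real $p\ge 2k-1$ and any $z\in\mathbb{R}$, $$|\mathbb{P}(W\le z)-\mathbb{P}(Y_k\le z)|\le\frac{B^p\left(p^{p/k}+\mathbb{E}|W|^{2p}\right)}{(1+|z|)^p}\left(\sqrt{\mathbb{E}\left(1-\frac{1}{2\lambda}\mathbb{E}(\Delta^2\mid W)\right)^2}+\frac{\sqrt{\mathbb{E}R^2}}{\lambda}+a+\frac{a^3}{\lambda}+\frac{\sqrt{\mathbb{E}\left[\Delta^4\mathbf{1}(|\Delta|>a)\right]}}{\lambda}\right).$$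
   Context: A pair $(W,W')$ of random variables is exchangeable if $(W,W')$ and $(W',W)$ have the same distribution. $\mathbf{1}(\cdot)$ denotes the indicator of an event. If an expectation on the right-hand side is infinite (e.g. $\mathbb{E}|W|^{2p}=\infty$), the right-hand side is understood as $+\infty$ and the bound is trivial. *)

(* Defs.v *)
From HB Require Import structures.
From mathcomp Require Import all_boot all_order all_algebra.
From mathcomp Require Import all_classical all_reals all_analysis.
From mathcomp Require Import measurable_realfun.

Set Implicit Arguments.
Unset Strict Implicit.
Unset Printing Implicit Defensive.

Import Order.TTheory GRing.Theory Num.Theory.
Import numFieldNormedType.Exports.

Local Open Scope classical_set_scope.
Local Open Scope ring_scope.

Definition exchangeable (R : realType) (d : measure_display)
    (T : measurableType d) (P : probability T R) (W W' : {RV P >-> R}) : Prop :=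
  forall A : set (R * R), measurable A ->
    pushforward P (fun w => (W w, W' w)) A =
    pushforward P (fun w => (W' w, W w)) A.

(* [C] is a version of the conditional expectation E(X | W). The expectation
   of [X] must exist, possibly as +oo or -oo; accordingly [C] takes extended
   real values. In this way E(X | W) is also available for every X >= 0. *)
Definition is_cond_expectation (R : realType) (d : measure_display)
    (T : measurableType d) (P : probability T R)
    (W : {RV P >-> R}) (X : T -> R) (C : T -> \bar R) : Prop :=
  [/\ measurable_fun setT X,
      (\int[P]_w (EFin \o X)^\+ w < +oo \/ \int[P]_w (EFin \o X)^\- w < +oo)%E,
      measurable_fun setT (C : g_sigma_algebra_preimageType W -> \bar R)
    & forall A : set R, measurable A ->
        (\int[P]_(w in W @^-1` A) C w = \int[P]_(w in W @^-1` A) (X w)%:E)%E].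

Definition has_density (R : realType) (d : measure_display)
    (T : measurableType d) (P : probability T R) (Y : {RV P >-> R})
    (f : R -> R) : Prop :=
  forall A : set R, measurable A ->
    distribution P Y A = (\int[lebesgue_measure]_(x in A) (f x)%:E)%E.

Definition b_ (R : realType) (k : nat) (ak : R) : R :=
  (\int[lebesgue_measure]_x expR (- (ak * x ^+ (2 * k))))^-1.

Definition p_ (R : realType) (k : nat) (ak : R) (x : R) : R :=
  b_ k ak * expR (- (ak * x ^+ (2 * k))).

Definition psi (R : realType) (k : nat) (ak : R) (x : R) : R :=
  2 * k%:R * ak * x ^+ (2 * k - 1).

(* Main.v *)
Require Import Defs.
From mathcomp Require Import all_boot all_order all_algebra.
From mathcomp Require Import all_classical all_reals all_analysis.
From mathcomp Require Import measurable_realfun.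
From mathcomp Require Import ring lra.

Import Order.TTheory GRing.Theory Num.Theory.
Import numFieldNormedType.Exports.

Local Open Scope classical_set_scope.
Local Open Scope ring_scope.

Set Implicit Arguments.
Unset Strict Implicit.
Unset Printing Implicit Defensive.

(** Let [F] be the distribution function of [Y] and [psi] the derivative of
    [ak x^(2k)], so that [F' = b exp (- ak x^(2k))].  The proof is Stein's
    method.  The bounded solution [f] of the Stein equation
    [f' - psi f = 1(. <= z) - F z] turns [P (W <= z) - F z] into
    [E (f'(W) - psi(W) f(W))].  Exchangeability and the regression condition
    give [2 lambda E psi(W) f(W) = 2 E f(W) R + E Delta (f(W) - f(W'))], and
    hence ([stein_decomposition])
    [[
      P (W <= z) - F z = E f'(W) (1 - E(Delta^2 | W) / (2 lambda))
        - E f(W) R / lambda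
        + E (f'(W) Delta^2 - Delta (f(W) - f(W'))) / (2 lambda).
    ]]

    The decay in [z] comes from pointwise bounds on [f].  For [z >= 0] both
    [|f|] and [|f'|] are at most a constant times the ratio
    [exp (- ak z^(2k)) / exp (- ak x^(2k))], with [x] truncated to [0, z]; these
    bounds only use the Mills ratio [(1 - F) / F'].  With
    [q^(2k) = p], this ratio is at most [u(x) / (1 + |z|)^p] where
    [u(x) = (C (|x| + q))^p]: where [x >= z / 2] the factor [|x| / (1 + z)] is
    bounded below, and where [x < z / 2] the ratio is exponentially small in
    [z^(2k)], which beats the power of [z] at the cost of [q]
    ([tail_ratio_envelope]).  Likewise [psi f] has Lipschitz constant at most
    [u(x)^2 / (1 + |z|)^p] on the unit interval around [x]; this uses
    [2k - 1 <= p].  These facts are collected in [stein_pair], and the case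
    [z < 0] follows by reflection ([stein_pair_exists]).

    For the probabilistic part put [V = E u(W)^2], which is at most a constant
    to the power [p] times [p^(p/k) + E |W|^(2p)].  By Cauchy-Schwarz the first
    two terms of the decomposition, as well as the part of the third on
    [|Delta| > a], are at most [V / (1 + |z|)^p] times the corresponding
    second-moment norms.  On [|Delta| <= a] the Taylor estimate for [f] leaves a
    cubic term and, because of the jump of [f'] at [z], the quantity
    [E Delta^2 1(|Delta| <= a, |W - z| <= a)].  The latter is at most
    [E Delta (g(W) - g(W'))] for the truncated linear function [g = clamp z a],
    and the regression condition bounds this by a multiple of
    [a lambda (1 + |R|_2 / lambda) V / (1 + |z|)^p], since [g] vanishes where
    [|x| < |z| - 2].  This requires [a <= 1]; for [a > 1] the bound is implied
    by [|1(x <= z) - F z| <= u(x) / (1 + |z|)^p]. *)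

(** * Derivatives and the mean value theorem *)

Lemma is_derive_mul (R : realType) (f g : R -> R) (x df dg : R) :
  is_derive x (1 : R) f df -> is_derive x (1 : R) g dg ->
  is_derive x (1 : R) (fun y => f y * g y) (df * g x + f x * dg).
Proof.
move=> hf hg; apply: (is_derive_eq (is_deriveM hf hg)).
by rewrite /GRing.scale /=; ring.
Qed.

Lemma is_derive_add (R : realType) (f g : R -> R) (x df dg : R) :
  is_derive x (1 : R) f df -> is_derive x (1 : R) g dg ->
  is_derive x (1 : R) (fun y => f y + g y) (df + dg).
Proof. by move=> hf hg; exact: (is_deriveD hf hg). Qed.

Lemma is_derive_sub (R : realType) (f g : R -> R) (x df dg : R) :
  is_derive x (1 : R) f df -> is_derive x (1 : R) g dg ->
  is_derive x (1 : R) (fun y => f y - g y) (df - dg).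
Proof. by move=> hf hg; exact: (is_deriveB hf hg). Qed.

Lemma is_derive_scale (R : realType) (c : R) (f : R -> R) (x df : R) :
  is_derive x (1 : R) f df -> is_derive x (1 : R) (fun y => c * f y) (c * df).
Proof. by move=> hf; exact: (is_deriveZ c hf). Qed.

Lemma is_derive_reflect (R : realType) (f : R -> R) (x df : R) :
  is_derive (- x) (1 : R) f df -> is_derive x (1 : R) (fun y => f (- y)) (- df).
Proof.
move=> hf; have hN : is_derive x (1 : R) (-%R : R -> R) (-1).
  by apply: (is_derive_eq (is_deriveN (is_derive_id x (1 : R)))).
by apply: (is_derive_eq (is_derive1_comp hf hN)); rewrite mulrN1.
Qed.

Lemma is_derive_power (R : realType) (n : nat) (x : R) :
  is_derive x (1 : R) (fun y => y ^+ n) (n%:R * x ^+ n.-1).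
Proof.
have -> : (fun y : R => y ^+ n) = (id : R -> R) ^+ n.
  by apply/funext => y; rewrite exprfctE.
apply: (is_derive_eq (is_deriveX n (is_derive_id x (1 : R)))).
by rewrite /GRing.scale /= mulr1.
Qed.

Lemma MVT_everywhere (R : realType) (f df : R -> R) (a b : R) : a <= b ->
  (forall x, x \in `[a, b] -> is_derive x (1 : R) f (df x)) ->
  exists2 c, a <= c <= b & f b - f a = df c * (b - a).
Proof.
move=> ab hf.
have hoo x : x \in `]a, b[ -> is_derive x (1 : R) f (df x).
  by rewrite in_itv /= => /andP[h1 h2]; apply: hf; rewrite in_itv /= !ltW.
have hc : {within `[a, b], continuous f}.
  by apply: derivable_within_continuous => x /hf[].
have [c] := MVT_segment ab hoo hc.
by rewrite in_itv /= => hcab E; exists c.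
Qed.

(** * The weight exp (- ak x^(2k)) and its logarithmic derivative *)

Section potential.
Context {R : realType}.
Variables (k : nat) (ak : R).
Hypotheses (hk : (0 < k)%N) (hak : 0 < ak).

(** The unnormalised density of [Y]. *)
Definition weight (x : R) : R := expR (- (ak * x ^+ (2 * k))).

Lemma weight_gt0 (x : R) : 0 < weight x. Proof. exact: expR_gt0. Qed.

Lemma weightN (x : R) : weight (- x) = weight x.
Proof. by rewrite /weight exprM sqrrN -exprM. Qed.

Lemma weight0 : weight 0 = 1.
Proof.
by rewrite /weight expr0n muln_eq0 (gtn_eqF hk) /= mulr0 oppr0 expR0.
Qed.

Lemma even_pow_le (x y : R) : 0 <= x -> x <= y -> x ^+ (2 * k) <= y ^+ (2 * k).
Proof. by move=> x0 xy; rewrite lerXn2r// nnegrE (le_trans x0). Qed.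

Lemma weight_nonincreasing (x y : R) : 0 <= x -> x <= y -> weight y <= weight x.
Proof.
move=> x0 xy; rewrite /weight ler_expR lerN2 ler_pM2l//.
exact: even_pow_le.
Qed.

Lemma psiN (x : R) : psi k ak (- x) = - psi k ak x.
Proof.
have o : odd (2 * k - 1) by rewrite oddB ?muln_gt0 // oddM.
by rewrite /psi exprNn -signr_odd o expr1 mulN1r mulrN.
Qed.

Lemma psi_ge0 (x : R) : 0 <= x -> 0 <= psi k ak x.
Proof. by move=> x0; rewrite /psi !mulr_ge0// ?exprn_ge0// ltW. Qed.

Lemma psi_nondecreasing (x y : R) : 0 <= x -> x <= y ->
  psi k ak x <= psi k ak y.
Proof.
move=> x0 xy; rewrite /psi ler_wpM2l//; first by rewrite !mulr_ge0// ltW.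
by rewrite lerXn2r// nnegrE (le_trans x0).
Qed.

Lemma normr_psi (x : R) : `|psi k ak x| = 2 * k%:R * ak * `|x| ^+ (2 * k - 1).
Proof.
by rewrite /psi !normrM normrX (ger0_norm (ltW hak)) !normr_nat.
Qed.

Lemma is_derive_psi (x : R) :
  is_derive x (1 : R) (psi k ak)
    (2 * k%:R * ak * ((2 * k - 1)%:R * x ^+ (2 * k - 1).-1)).
Proof. by rewrite /psi; apply: is_derive_scale; exact: is_derive_power. Qed.

Lemma is_derive_exponent (x : R) :
  is_derive x (1 : R) (fun y => ak * y ^+ (2 * k)) (psi k ak x).
Proof.
apply: (is_derive_eq (is_derive_scale ak (is_derive_power (2 * k) x))).
by rewrite /psi -subn1 natrM; ring.
Qed.

Lemma is_derive_weight (x : R) :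
  is_derive x (1 : R) weight (- psi k ak x * weight x).
Proof.
have h := is_deriveN (is_derive_exponent x).
apply: (is_derive_eq (is_derive1_comp (is_derive_expR _) h)).
by rewrite /= mulrC.
Qed.

Lemma is_derive_weightV (x : R) :
  is_derive x (1 : R) (fun y => (weight y)^-1) (psi k ak x * (weight x)^-1).
Proof.
have -> : (fun y => (weight y)^-1) = expR \o (fun y => ak * y ^+ (2 * k)).
  by apply/funext => y; rewrite /weight expRN invrK.
apply: (is_derive_eq (is_derive1_comp (is_derive_expR _)
  (is_derive_exponent x))).
by rewrite /weight expRN invrK mulrC.
Qed.

End potential.

(** * The Mills ratio of the target law *)

Section mills_ratio.
Context {R : realType}.
Variables (k : nat) (ak b : R) (F : R -> R).
Hypotheses (hk : (0 < k)%N) (hak : 0 < ak) (hb : 0 < b).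
Hypothesis hF : forall x : R, is_derive x (1 : R) F (b * weight k ak x).
Hypothesis F_ge0 : forall x, 0 <= F x.
Hypothesis F_le1 : forall x, F x <= 1.
Hypothesis F_sym : forall x, F (- x) = 1 - F x.
Hypothesis F_lim : forall eps : R, 0 < eps ->
  exists t0, forall t, t0 <= t -> 1 - F t <= eps.

Local Notation weight := (weight k ak).
Local Notation psi := (psi k ak).

(** The Mills ratio [(1 - F) / F'], where [F' = b weight]. *)
Definition mills (x : R) : R := b^-1 * ((1 - F x) * (weight x)^-1).

Lemma tailE (x : R) : 1 - F x = mills x * (b * weight x).
Proof.
rewrite /mills; have := weight_gt0 k ak x; set w := weight x => w0.
by field; rewrite !gt_eqF.
Qed.

Lemma mills_ge0 (x : R) : 0 <= mills x.
Proof.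
rewrite /mills mulr_ge0 ?invr_ge0 ?(ltW hb)// mulr_ge0 ?subr_ge0//.
by rewrite invr_ge0 ltW// weight_gt0.
Qed.

Lemma mills0 : mills 0 = (2 * b)^-1.
Proof.
have := F_sym 0; rewrite oppr0 => F0.
have {}F0 : F 0 = 2^-1 by lra.
rewrite /mills weight0// F0; field.
by rewrite gt_eqF.
Qed.

Lemma is_derive_mills (x : R) :
  is_derive x (1 : R) mills (psi x * mills x - 1).
Proof.
have h1 := is_derive_sub (is_derive_cst (1 : R) x (1 : R)) (hF x).
have h2 := is_derive_mul h1 (is_derive_weightV k ak x).
have h3 := is_derive_scale b^-1 h2.
apply: (is_derive_eq h3); rewrite /mills /cst.
have := weight_gt0 k ak x; set w := weight x => w0.
by field; rewrite !gt_eqF.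
Qed.

(** For fixed [x], the function [t |-> b w(t) - psi x (1 - F t)] decreases on
    [t >= x] and its limit at infinity is not negative. *)
Lemma psi_mills_le1 (x : R) : 0 <= x -> psi x * mills x <= 1.
Proof.
move=> x0; have px := psi_ge0 k hak x0.
pose D t := b * weight t - psi x * (1 - F t).
have hD (t : R) : is_derive t (1 : R) D
    (b * (- psi t * weight t) - psi x * (0 - b * weight t)).
  have h1 := is_derive_scale b (is_derive_weight k ak t).
  have h2 := is_derive_sub (is_derive_cst (1 : R) t (1 : R)) (hF t).
  exact: is_derive_sub h1 (is_derive_scale (psi x) h2).
have Ddec (t : R) : x <= t -> D t <= D x.
  move=> xt; have [c /andP[xc _] E] := MVT_everywhere xt (fun y _ => hD y).
  rewrite -subr_le0 E mulr_le0_ge0 ?subr_ge0//.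
  have : psi x <= psi c by exact: psi_nondecreasing.
  have := weight_gt0 k ak c; set w := weight c => w0 h.
  have -> : b * (- psi c * w) - psi x * (0 - b * w) =
    - ((b * w) * (psi c - psi x)) by ring.
  by rewrite oppr_le0 mulr_ge0 ?subr_ge0// mulr_ge0 ?ltW.
have Dx : 0 <= D x.
  rewrite leNgt; apply/negP => Dx.
  (* a tail below [eps] makes [psi x * (1 - F t)] at most [- D x / 2] *)
  pose eps := - D x / (psi x + 1) / 2.
  have e0 : 0 < eps by rewrite !divr_gt0 ?oppr_gt0//; lra.
  have eE : eps * (psi x + 1) = - D x / 2.
    by rewrite /eps; field; rewrite gt_eqF //; lra.
  have [t0 ht0] := F_lim e0.
  have := Ddec (Num.max t0 x); rewrite le_max lexx orbT => /(_ isT).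
  have := ht0 (Num.max t0 x); rewrite le_max lexx => /(_ isT).
  set t := Num.max t0 x => h1 h2.
  have h3 : psi x * (1 - F t) <= psi x * eps by rewrite ler_wpM2l.
  rewrite mulrDr mulr1 mulrC in eE.
  have h5 : 0 < b * weight t by rewrite mulr_gt0// weight_gt0.
  by move: h2; rewrite {1}/D; lra.
have w0 := weight_gt0 k ak x.
have bw : 0 < b * weight x by rewrite mulr_gt0.
rewrite -(ler_pM2r bw) mul1r -mulrA -tailE.
by move: Dx; rewrite /D subr_ge0.
Qed.

(** The Mills ratio decreases on [x >= 0], its derivative being
    [psi * mills - 1]. *)
Lemma mills_le (x : R) : 0 <= x -> mills x <= (2 * b)^-1.
Proof.
move=> x0; rewrite -mills0 -subr_le0.
have [c /andP[c0 _] ->] := MVT_everywhere x0 (fun y _ => is_derive_mills y).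
by rewrite mulr_le0_ge0 ?subr_ge0// subr_le0 psi_mills_le1.
Qed.

Lemma tail_le (x : R) : 0 <= x -> 1 - F x <= weight x / 2.
Proof.
move=> x0; rewrite tailE; have := mills_le x0.
have w0 := weight_gt0 k ak x; rewrite -(ler_pM2r (mulr_gt0 hb w0)).
move=> /le_trans; apply; rewrite le_eqVlt; apply/orP; left; apply/eqP.
by field; rewrite gt_eqF.
Qed.

End mills_ratio.

(** * The solution of the Stein equation for nonnegative z *)

(** A function that is differentiable on each side of [z], and continuous at
    [z] because both pieces describe it there, is Lipschitz between [x] and [y]
    with the bound for the one-sided derivatives. *)
Lemma lipschitz_glue (R : realType) (g gL gR dL dR : R -> R) (z M x y : R) :
  (forall t, t <= z -> g t = gL t) -> (forall t, z <= t -> g t = gR t) ->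
  (forall t, is_derive t (1 : R) gL (dL t)) ->
  (forall t, is_derive t (1 : R) gR (dR t)) ->
  (forall t, Num.min x y <= t <= Num.max x y -> t <= z -> `|dL t| <= M) ->
  (forall t, Num.min x y <= t <= Num.max x y -> z <= t -> `|dR t| <= M) ->
  `|g x - g y| <= M * `|x - y|.
Proof.
move=> gLE gRE hL hR; wlog xy : x y / x <= y => [hw|].
  have [|yx] := orP (le_total x y); first exact: hw.
  rewrite minC maxC (distrC (g x)) (distrC x) => h1 h2; exact: hw yx h1 h2.
rewrite (min_idPl xy) (max_idPr xy) => bL bR.
have left u v : x <= u -> u <= v -> v <= y -> v <= z ->
    `|g u - g v| <= M * (v - u).
  move=> xu uv vy vz; rewrite distrC !gLE ?(le_trans uv)//.
  have [c /andP[uc cv] ->] := MVT_everywhere uv (fun t _ => hL t).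
  rewrite normrM (ger0_norm (x := v - u)) ?subr_ge0// ler_wpM2r ?subr_ge0//.
  by apply: bL; rewrite ?(le_trans xu uc) ?(le_trans cv).
have right u v : x <= u -> u <= v -> v <= y -> z <= u ->
    `|g u - g v| <= M * (v - u).
  move=> xu uv vy zu; rewrite distrC !gRE ?(le_trans zu)//.
  have [c /andP[uc cv] ->] := MVT_everywhere uv (fun t _ => hR t).
  rewrite normrM (ger0_norm (x := v - u)) ?subr_ge0// ler_wpM2r ?subr_ge0//.
  by apply: bR; rewrite ?(le_trans xu uc) ?(le_trans cv) ?(le_trans zu).
rewrite (distrC x) (ger0_norm (x := y - x)) ?subr_ge0//.
have [yz|/ltW zy] := leP y z; first exact: left.
have [zx|/ltW xz] := leP z x; first exact: right.
rewrite (le_trans (ler_distD (g z) _ _))//.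
have -> : M * (y - x) = M * (z - x) + M * (y - z) by ring.
by apply: lerD; [apply: left|apply: right].
Qed.

(** The ratio [weight z / weight x], with [x] truncated to the interval from [0]
    to [z]: it governs the size of the Stein solution on the whole line when
    [0 <= z]. *)
Definition tail_ratio (R : realType) (k : nat) (ak z x : R) : R :=
  weight k ak z / weight k ak (Num.max 0 (Num.min x z)).

Section stein_solution.
Context {R : realType}.
Variables (k : nat) (ak b : R) (F : R -> R).
Hypotheses (hk : (0 < k)%N) (hak : 0 < ak) (hb : 0 < b).
Hypothesis hF : forall x : R, is_derive x (1 : R) F (b * weight k ak x).
Hypothesis F_ge0 : forall x, 0 <= F x.
Hypothesis F_le1 : forall x, F x <= 1.
Hypothesis F_sym : forall x, F (- x) = 1 - F x.
Hypothesis F_lim : forall eps : R, 0 < eps ->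
  exists t0, forall t, t0 <= t -> 1 - F t <= eps.
Variables (z : R) (s : bool).
Hypothesis z0 : 0 <= z.

Local Notation weight := (weight k ak).
Local Notation psi := (psi k ak).
Local Notation mills := (mills k ak b F).
Local Notation rho := (tail_ratio k ak z).

(** The two branches [(1 - F z) F x / F' x] and [F z (1 - F x) / F' x] of the
    bounded solution; the symmetry of [F] expresses the first one by the Mills
    ratio at [- x].  Both branches agree at [z] ([solRE]). *)
Definition solL (x : R) : R := (1 - F z) * mills (- x).
Definition solR (x : R) : R := F z * mills x.
Definition sol (x : R) : R := if x <= z then solL x else solR x.
(** The indicator of [x <= z], or of [x < z] when [s] is false. *)
Definition step (x : R) : R := (if s then x <= z else x < z)%:R.
(** The derivative of [sol] away from [z]; at [z] its value is dictated by the
    Stein equation. *)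
Definition dsol (x : R) : R := psi x * sol x + step x - F z.

Lemma solLE (t : R) : t <= z -> sol t = solL t.
Proof. by rewrite /sol => ->. Qed.

Lemma solRE (t : R) : z <= t -> sol t = solR t.
Proof.
rewrite le_eqVlt => /predU1P[<-|zt]; last by rewrite /sol leNgt zt.
rewrite /sol lexx /solL /solR /mills weightN F_sym; ring.
Qed.

Lemma is_derive_solL (t : R) :
  is_derive t (1 : R) solL (psi t * solL t + (1 - F z)).
Proof.
have h := is_derive_reflect (is_derive_mills hb hF (- t)).
apply: (is_derive_eq (is_derive_scale (1 - F z) h)).
by rewrite psiN // /solL; ring.
Qed.

Lemma is_derive_solR (t : R) :
  is_derive t (1 : R) solR (psi t * solR t - F z).
Proof.
apply: (is_derive_eq (is_derive_scale (F z) (is_derive_mills hb hF t))).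
by rewrite /solR; ring.
Qed.

Lemma tail_ratio_gt0 (x : R) : 0 < rho x.
Proof. by rewrite divr_gt0 ?weight_gt0. Qed.

Lemma tail_ratioM (x : R) : 0 <= x -> x <= z -> rho x = weight z / weight x.
Proof. by move=> x0 xz; rewrite /tail_ratio (min_idPl xz) (max_idPr x0). Qed.

Lemma tail_ratioR (x : R) : z <= x -> rho x = 1.
Proof.
move=> zx; rewrite /tail_ratio (min_idPr zx) (max_idPr z0) divff //.
by rewrite gt_eqF // weight_gt0.
Qed.

Lemma weight_le_tail_ratio (x : R) : weight z <= rho x.
Proof.
rewrite /tail_ratio ler_peMr ?(ltW (weight_gt0 _ _ _))//.
rewrite invf_ge1 ?weight_gt0//.
rewrite -[leRHS](weight0 ak hk) weight_nonincreasing//.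
by rewrite le_max lexx.
Qed.

Lemma tail_le_ratio (x : R) : 1 - F z <= rho x.
Proof.
apply: le_trans (weight_le_tail_ratio x).
have := tail_le hk hak hb hF F_sym F_lim z0.
have := weight_gt0 k ak z; lra.
Qed.

Lemma normr_step_sub_le (x : R) : `|step x - F z| <= rho x.
Proof.
have [xz|zx] := ltP x z.
  rewrite /step (ltW xz) xz if_same /= ger0_norm ?subr_ge0//.
  exact: tail_le_ratio.
rewrite (tail_ratioR zx).
have : 0 <= step x <= 1 by rewrite /step ler0n lern1 leq_b1.
by have := F_le1 z; have := F_ge0 z; rewrite ler_norml; lra.
Qed.

Lemma sol_ge0 (x : R) : 0 <= sol x.
Proof.
by rewrite /sol; case: ifP => _; rewrite mulr_ge0 ?subr_ge0 ?mills_ge0.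
Qed.

(** On [0, z] the solution is [F x * mills z * w z / w x]. *)
Lemma sol_middle (x : R) : 0 <= x -> x <= z ->
  sol x = F x * (mills z * rho x).
Proof.
move=> x0 xz; rewrite (solLE xz) (tail_ratioM x0 xz) /solL.
rewrite (tailE k ak F hb z) {2}/mills weightN F_sym.
have := weight_gt0 k ak x; set w := weight x => w0.
by field; rewrite !gt_eqF.
Qed.

Lemma sol_le (x : R) : sol x <= (2 * b)^-1 * rho x.
Proof.
have r0 : 0 <= (2 * b)^-1 by rewrite invr_ge0 mulr_ge0 ?(ltW hb).
have ml := mills_le hk hak hb hF F_sym F_lim.
have m0 := mills_ge0 k ak hb F_le1.
have [x0|/ltW x0] := leP x 0.
  rewrite solLE ?(le_trans x0)// /solL mulrC.
  by rewrite ler_pM ?subr_ge0 ?tail_le_ratio ?ml ?oppr_ge0.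
have [xz|/ltW zx] := leP x z.
  have rx := ltW (tail_ratio_gt0 x).
  rewrite sol_middle // -[leRHS]mul1r; apply: ler_pM => //.
    by rewrite mulr_ge0.
  by rewrite ler_wpM2r ?ml.
rewrite solRE // tail_ratioR // mulr1 -[leRHS]mul1r.
by rewrite ler_pM // ml // (le_trans z0).
Qed.

Lemma psi_sol_le (x : R) : `|psi x| * sol x <= rho x.
Proof.
have pm := psi_mills_le1 hak hb hF F_lim.
have m0 := mills_ge0 k ak hb F_le1.
have [x0|/ltW x0] := leP x 0.
  apply: le_trans (tail_le_ratio x).
  rewrite solLE ?(le_trans x0)// /solL mulrCA ler_piMr ?subr_ge0//.
  rewrite -normrN -psiN // ger0_norm ?psi_ge0 ?oppr_ge0//.
  by rewrite pm // oppr_ge0.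
rewrite ger0_norm ?psi_ge0//.
have [xz|/ltW zx] := leP x z.
  have rx := ltW (tail_ratio_gt0 x).
  rewrite sol_middle // mulrCA mulrA mulrA ler_piMl// -mulrA.
  rewrite -[leRHS]mul1r; apply: ler_pM => //.
    by rewrite mulr_ge0 ?psi_ge0.
  apply: le_trans (pm z z0); rewrite ler_wpM2r //.
  exact: psi_nondecreasing.
rewrite solRE // tail_ratioR // mulrCA -[leRHS]mul1r; apply: ler_pM => //.
  by rewrite mulr_ge0 ?psi_ge0.
exact: pm.
Qed.

Lemma normr_psi_sol_le (x : R) : `|psi x * sol x| <= rho x.
Proof. by rewrite normrM (ger0_norm (sol_ge0 x)) psi_sol_le. Qed.

Lemma normr_dsol_le (x : R) : `|dsol x| <= 2 * rho x.
Proof.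
rewrite /dsol -addrA (le_trans (ler_normD _ _))//.
have := normr_psi_sol_le x; have := normr_step_sub_le x; lra.
Qed.

Lemma normr_dsolL_le (t : R) : t <= z ->
  `|psi t * solL t + (1 - F z)| <= 2 * rho t.
Proof.
move=> tz; rewrite -solLE // (le_trans (ler_normD _ _))//.
rewrite (ger0_norm (x := 1 - F z)) ?subr_ge0//.
have := normr_psi_sol_le t; have := tail_le_ratio t; lra.
Qed.

Lemma normr_dsolR_le (t : R) : z <= t -> `|psi t * solR t - F z| <= 2 * rho t.
Proof.
move=> zt; rewrite -solRE // (le_trans (ler_normB _ _))//.
rewrite (ger0_norm (x := F z))//.
have := normr_psi_sol_le t; have := F_le1 z; rewrite tail_ratioR //; lra.
Qed.

Lemma sol_lipschitz (x y M : R) :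
  (forall t, Num.min x y <= t <= Num.max x y -> rho t <= M) ->
  `|sol x - sol y| <= 2 * M * `|x - y|.
Proof.
move=> hM.
apply: (lipschitz_glue solLE solRE is_derive_solL is_derive_solR) => t ht tz.
  by rewrite (le_trans (normr_dsolL_le tz))// ler_wpM2l// hM.
by rewrite (le_trans (normr_dsolR_le tz))// ler_wpM2l// hM.
Qed.

(** The derivative of [psi]. *)
Definition dpsi (x : R) : R :=
  2 * k%:R * ak * ((2 * k - 1)%:R * x ^+ (2 * k - 1).-1).

(** The constant in the bound for the derivative of [psi * sol]: the bound
    [(2 b)^-1] for [sol] enters with [dpsi], the bound [2] for its derivative
    with [psi]. *)
Definition growth : R :=
  2 * k%:R * ak * ((2 * k - 1)%:R * (2 * b)^-1) + 2 * (2 * k%:R * ak).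

Lemma normr_dpsi_le (t : R) :
  `|dpsi t| <= 2 * k%:R * ak * (2 * k - 1)%:R * (1 + `|t|) ^+ (2 * k - 1).
Proof.
rewrite /dpsi !normrM !normr_nat normrX (ger0_norm (ltW hak)) !mulrA.
rewrite ler_wpM2l ?mulr_ge0 ?(ltW hak)//.
have t1 : 1 <= 1 + `|t| by rewrite lerDl.
apply: le_trans (_ : (1 + `|t|) ^+ (2 * k - 1).-1 <= _).
  by rewrite lerXn2r ?nnegrE ?addr_ge0// lerDr.
by rewrite ler_weXn2l // leq_pred.
Qed.

Lemma normr_psi_le (t : R) :
  `|psi t| <= 2 * k%:R * ak * (1 + `|t|) ^+ (2 * k - 1).
Proof.
rewrite normr_psi // ler_wpM2l ?mulr_ge0 ?(ltW hak)//.
by rewrite lerXn2r ?nnegrE ?addr_ge0// lerDr.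
Qed.

(** A common bound for the derivative of [psi * sol] on either side of [z],
    [u] being the value of [sol] and [v] that of its one-sided derivative. *)
Lemma normr_dpsi_sol_le (t u v : R) : `|u| <= (2 * b)^-1 * rho t ->
  `|v| <= 2 * rho t ->
  `|dpsi t * u + psi t * v| <= growth * (1 + `|t|) ^+ (2 * k - 1) * rho t.
Proof.
move=> hu hv; rewrite (le_trans (ler_normD _ _))//.
rewrite (normrM (dpsi t)) (normrM (psi t)).
set T := (1 + `|t|) ^+ (2 * k - 1).
have T0 : 0 <= T by rewrite exprn_ge0 ?addr_ge0.
have -> : growth * T * rho t =
    2 * k%:R * ak * (2 * k - 1)%:R * T * ((2 * b)^-1 * rho t)
    + 2 * k%:R * ak * T * (2 * rho t) by rewrite /growth; ring.
apply: lerD; apply: ler_pM => //; [exact: normr_dpsi_le|exact: normr_psi_le].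
Qed.

Lemma psi_sol_lipschitz (x y N : R) :
  (forall t, Num.min x y <= t <= Num.max x y ->
    growth * (1 + `|t|) ^+ (2 * k - 1) * rho t <= N) ->
  `|psi x * sol x - psi y * sol y| <= N * `|x - y|.
Proof.
move=> hN.
pose gL t := psi t * solL t; pose gR t := psi t * solR t.
pose g t := psi t * sol t.
have gLE t : t <= z -> g t = gL t by move=> tz; rewrite /g solLE.
have gRE t : z <= t -> g t = gR t by move=> tz; rewrite /g solRE.
have hL t := is_derive_mul (is_derive_psi k ak t) (is_derive_solL t).
have hR t := is_derive_mul (is_derive_psi k ak t) (is_derive_solR t).
apply: (lipschitz_glue gLE gRE hL hR) => t ht tz;
  apply: le_trans (hN t ht); apply: normr_dpsi_sol_le.
- by rewrite -solLE // ger0_norm ?sol_ge0 ?sol_le.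
- exact: normr_dsolL_le.
- by rewrite -solRE // ger0_norm ?sol_ge0 ?sol_le.
- exact: normr_dsolR_le.
Qed.

Lemma growth_ge0 : 0 <= growth.
Proof.
by rewrite addr_ge0 // !mulr_ge0 ?invr_ge0 ?mulr_ge0 ?(ltW hak) ?(ltW hb).
Qed.

(** First-order expansion of [min(x, z)], whose derivative is [step]: the error
    is nonzero only if [z] lies between [x] and [y]. *)
Lemma step_taylor (x y : R) :
  `|Num.min x z - Num.min y z - (x - y) * step x|
    <= `|x - y| * (`|x - z| <= `|x - y|)%R%:R.
Proof.
have [xz|zx] := leP x z.
  have [yz|zy] := leP y z.
    have [x1|x0] : step x = 1 \/ x = z.
      rewrite /step; case: s; first by left; rewrite xz.
      by move: xz; rewrite le_eqVlt => /predU1P[->|->]; [right|left].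
    - by rewrite x1 mulr1 subrr normr0 mulr_ge0.
    - have s01 : 0 <= step x <= 1 by rewrite /step ler0n lern1 leq_b1.
      rewrite x0 subrr normr0 normr_ge0 mulr1 -x0 ger0_norm.
        by rewrite ger0_norm; nra.
      by nra.
  have -> : `|x - z| <= `|x - y|.
    by rewrite distrC (distrC x) !ger0_norm; lra.
  have s01 : 0 <= step x <= 1 by rewrite /step ler0n lern1 leq_b1.
  by rewrite mulr1 (distrC x y) (ger0_norm (x := y - x)) ?ler_norml; nra.
have -> : step x = 0 by rewrite /step leNgt zx ltNge (ltW zx) if_same.
rewrite mulr0 subr0.
have [yz|zy] := leP y z; last by rewrite subrr normr0 mulr_ge0.
have -> : `|x - z| <= `|x - y| by rewrite !ger0_norm; lra.
by rewrite mulr1 !ger0_norm; lra.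
Qed.

Lemma between_dist (x y t : R) : Num.min x y <= t <= Num.max x y ->
  `|t - x| <= `|x - y|.
Proof.
by have [xy|yx] := leP x y => /andP[h1 h2];
  [rewrite (distrC x)|rewrite (distrC t)]; rewrite !ger0_norm; lra.
Qed.

Lemma between_sub (x y t u : R) : Num.min x y <= t <= Num.max x y ->
  Num.min t x <= u <= Num.max t x -> Num.min x y <= u <= Num.max x y.
Proof.
move=> /andP[t1 t2] /andP[u1 u2]; apply/andP; split.
  by apply: le_trans u1; rewrite le_min t1 ge_min lexx.
by apply: (le_trans u2); rewrite ge_max t2 le_max lexx.
Qed.

(** Subtracting from [sol] the function [min(t, z) - F z t], whose derivative is
    the right-hand side of the Stein equation, leaves a primitive of the
    Lipschitz function [psi * sol]. *)
Lemma sol_taylor (x y N : R) :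
  (forall t, Num.min x y <= t <= Num.max x y ->
    growth * (1 + `|t|) ^+ (2 * k - 1) * rho t <= N) ->
  `|sol x - sol y - (x - y) * dsol x|
    <= N * (x - y) ^+ 2 + `|x - y| * (`|x - z| <= `|x - y|)%R%:R.
Proof.
move=> hN.
pose c := psi x * sol x.
(* the derivative of [g] on either side of [z] is [psi t * sol t - c] *)
pose g t := sol t - (Num.min t z - F z * t + c * t).
pose gL t := solL t - (t - F z * t + c * t).
pose gR t := solR t - (z - F z * t + c * t).
have gLE t : t <= z -> g t = gL t.
  by move=> tz; rewrite /g /gL solLE // (min_idPl tz).
have gRE t : z <= t -> g t = gR t.
  by move=> tz; rewrite /g /gR solRE // (min_idPr tz).
have hid (t m : R) : is_derive t (1 : R) (fun y => m * y) m.
  apply: (is_derive_eq (is_derive_scale m (is_derive_id t (1 : R)))).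
  by rewrite mulr1.
have hL t := is_derive_sub (is_derive_solL t) (is_derive_add (is_derive_sub
  (is_derive_id t (1 : R)) (hid t (F z))) (hid t c)).
have hR t := is_derive_sub (is_derive_solR t) (is_derive_add (is_derive_sub
  (is_derive_cst z t (1 : R)) (hid t (F z))) (hid t c)).
have N0 : 0 <= N.
  have xx : Num.min x y <= x <= Num.max x y by rewrite ge_min le_max !lexx.
  apply: le_trans (hN x xx).
  rewrite mulr_ge0 ?(ltW (tail_ratio_gt0 _))//.
  by rewrite mulr_ge0 ?growth_ge0 ?exprn_ge0 ?addr_ge0.
have incr t : Num.min x y <= t <= Num.max x y ->
    `|psi t * sol t - c| <= N * `|x - y|.
  move=> ht; apply: le_trans (_ : N * `|t - x| <= _).
    by apply: psi_sol_lipschitz => u hu; apply: hN; exact: between_sub hu.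
  by rewrite ler_wpM2l// between_dist.
have gxy : `|g x - g y| <= N * `|x - y| * `|x - y|.
  apply: (lipschitz_glue gLE gRE hL hR) => t ht tz; apply: le_trans (incr t ht).
    by rewrite -solLE // le_eqVlt; apply/orP; left; apply/eqP; congr `|_|; ring.
  by rewrite -solRE // le_eqVlt; apply/orP; left; apply/eqP; congr `|_|; ring.
have -> : sol x - sol y - (x - y) * dsol x = (g x - g y)
    + (Num.min x z - Num.min y z - (x - y) * step x).
  by rewrite /g /dsol /c; ring.
rewrite (le_trans (ler_normD _ _))// lerD ?step_taylor//.
by move: gxy; rewrite -mulrA -expr2 real_normK ?num_real.
Qed.

End stein_solution.

(** * Solutions with polynomially decaying bounds *)

(** [f] and [df] solve the Stein equation with right-hand side [h - c], with
    [h] jumping at [z], and satisfy the bounds needed for a nonuniform estimate: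
    [kap] is the factor carrying the decay in [z] and [u] the growth in [x].
    [df] is the derivative of [f] away from [z], which [stein_taylor] expresses
    quantitatively. *)
Record stein_pair (R : realType) (psi h : R -> R) (c z kap : R)
    (u f df : R -> R) : Prop := SteinPair {
  stein_equation : forall x, h x - c = df x - psi x * f x;
  stein_rhs_le : forall x, `|h x - c| <= kap * u x;
  stein_sol_le : forall x, `|f x| <= kap * u x;
  stein_dsol_le : forall x, `|df x| <= kap * u x;
  stein_lipschitz : forall x y, `|f x - f y| <= `|x - y| * (kap * (u x + u y));
  stein_taylor : forall x y, `|x - y| <= 1 ->
    `|f x - f y - (x - y) * df x| <= kap * u x ^+ 2 * (x - y) ^+ 2
      + `|x - y| * (`|x - z| <= `|x - y|)%R%:R;
  stein_bounded : exists K : R, forall x, `|f x| <= K /\ `|df x| <= K;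
  stein_measurable : measurable_fun setT f;
  stein_dmeasurable : measurable_fun setT df }.

(** The equation for [- z] is obtained by reflecting [f]; the value of [h] at
    the jump point is reflected too. *)
Lemma stein_pair_reflect (R : realType) (psi h : R -> R) (c z kap : R)
    (u f df : R -> R) :
  (forall x, psi (- x) = - psi x) -> (forall x, u (- x) = u x) ->
  stein_pair psi h c z kap u f df ->
  stein_pair psi (fun x => 1 - h (- x)) (1 - c) (- z) kap u
    (fun x => f (- x)) (fun x => - df (- x)).
Proof.
move=> psiN uN [eqn hle fle dle lip tay [K hK] mf mdf].
have mN : measurable_fun setT (-%R : R -> R) by exact: oppr_measurable.
have NB (x y : R) : `|- x - - y| = `|x - y|.
  by rewrite -normrN; congr `|_|; ring.
split=> [x|x|x|x|x y|x y|||].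
- by have := eqn (- x); rewrite psiN; lra.
- have -> : 1 - h (- x) - (1 - c) = - (h (- x) - c) by ring.
  by rewrite normrN -(uN x).
- by rewrite -(uN x).
- by rewrite normrN -(uN x).
- by rewrite -(uN x) -(uN y) -(NB x y).
- move=> xy; have := tay (- x) (- y); rewrite !NB uN => /(_ xy).
  have -> : - x - z = - (x - - z) by ring.
  rewrite normrN.
  have -> : (- x - - y) ^+ 2 = (x - y) ^+ 2 by ring.
  by have -> : f (- x) - f (- y) - (- x - - y) * df (- x) =
    f (- x) - f (- y) - (x - y) * - df (- x) by ring.
- by exists K => x; rewrite normrN.
- exact: measurableT_comp.
- by apply: measurableT_comp => //; exact: measurableT_comp.
Qed.

(** The growth in [x] of the bounds, with [q^(2k) = p] in all applications. *)
Definition envelope (R : realType) (C q p x : R) : R := (C * (`|x| + q)) `^ p.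

Lemma scale_powR (R : realType) (m c w p : R) : 0 <= m -> m <= c -> 1 <= c ->
  0 <= w -> 1 <= p -> m * w `^ p <= (c * w) `^ p.
Proof.
move=> m0 mc c1 w0 p1; rewrite powRM ?(le_trans _ c1)//.
by rewrite ler_wpM2r ?powR_ge0// (le_trans mc)// le1r_powR.
Qed.

Lemma exponent_ge1 (R : realType) (k : nat) (p : R) : (0 < k)%N ->
  2 * k%:R - 1 <= p -> 1 <= p.
Proof.
move=> hk; apply: le_trans; have k1 : 1 <= k%:R :> R by rewrite ler1n.
by rewrite lerBrDr -[leLHS]/(2 : R) -[leLHS]mulr1 ler_wpM2l.
Qed.

Section envelope_bounds.
Context {R : realType}.
Variables (k : nat) (ak : R).
Hypotheses (hk : (0 < k)%N) (hak : 0 < ak).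
Variables (p q : R).
Hypotheses (p_ge : 2 * k%:R - 1 <= p) (q1 : 1 <= q) (pq : q ^+ (2 * k) = p).

Local Notation weight := (weight k ak).

Let A : R := 2 + 2 / ak.

Let A2 : 2 <= A. Proof. by rewrite lerDl divr_ge0 ?(ltW hak). Qed.

Let p1 : 1 <= p. Proof. exact: exponent_ge1 hk p_ge. Qed.

(** With [y = z / q], the inequality is [1 + y <= A exp (c y^(2k))] raised to
    the power [p = q^(2k)]. *)
Lemma weight_ratio_le (z : R) : 0 <= z ->
  weight z / weight (z / 2) <= (A * q / (1 + z)) `^ p.
Proof.
move=> z0; pose y := z / q.
have q0 : 0 < q by apply: lt_le_trans q1.
have p0 : 0 <= p by apply: le_trans p1.
have y0 : 0 <= y by rewrite divr_ge0 // ltW.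
set Y := y ^+ (2 * k).
have Y0 : 0 <= Y by rewrite exprn_ge0.
have zE : z ^+ (2 * k) = p * Y.
  by rewrite /Y /y expr_div_n pq mulrC divfK // gt_eqF // (lt_le_trans ltr01).
have half : (2^-1 : R) ^+ (2 * k) <= 2^-1.
  rewrite -[leRHS]expr1; apply: ler_wiXn2l; [by lra|by lra|].
  by rewrite muln_gt0.
have y1 : 1 + y <= 2 + Y.
  have [yle|ygt] := leP y 1; first by lra.
  have : y <= Y.
    by rewrite -[leLHS]expr1 ler_weXn2l ?(ltW ygt)// muln_gt0.
  by lra.
pose c := ak / 2.
have key : expR (- (c * Y)) <= A * q / (1 + z).
  rewrite expRN -div1r ler_pdivrMr ?expR_gt0// mulrAC ler_pdivlMr; last by lra.
  rewrite mul1r.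
  have e1 : 1 + c * Y <= expR (c * Y) by exact: expR_ge1Dx.
  have e2 : 1 + z <= q * (1 + y).
    by rewrite mulrDr mulr1 /y mulrCA divff ?gt_eqF// mulr1 lerD2r.
  apply: (le_trans e2); apply: (@le_trans _ _ (q * (A * (1 + c * Y)))).
    rewrite ler_pM2l//; apply: (le_trans y1).
    have -> : A * (1 + c * Y) = A + (ak + 1) * Y.
      by rewrite /A /c; field; rewrite gt_eqF.
    have : 0 <= ak * Y by rewrite mulr_ge0 // ltW.
    by have := A2; lra.
  rewrite mulrA (mulrC q) ler_wpM2l ?mulr_ge0 ?(ltW q0)//.
  by rewrite (le_trans _ A2).
apply: le_trans (_ : expR (- (c * Y)) `^ p <= _); last first.
  by apply: ge0_ler_powR; rewrite ?nnegrE ?expR_ge0 ?p0//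
    (le_trans (expR_ge0 _) key).
rewrite -expRM /weight -expRN -expRD ler_expR opprK expr_div_n -exprVn zE.
rewrite -subr_ge0.
have -> : - (c * Y) * p - (- (ak * (p * Y)) + ak * (p * Y * 2^-1 ^+ (2 * k)))
  = ak * p * Y * (2^-1 - 2^-1 ^+ (2 * k)) by rewrite /c; field.
rewrite mulr_ge0 ?subr_ge0// mulr_ge0// mulr_ge0 ?(ltW hak)//.
Qed.

Lemma tail_ratio_le1 (z x : R) : 0 <= z -> tail_ratio k ak z x <= 1.
Proof.
move=> z0; rewrite /tail_ratio ler_pdivrMr ?weight_gt0// mul1r.
apply: weight_nonincreasing => //; first by rewrite le_max lexx.
by rewrite ge_max z0 ge_min lexx orbT.
Qed.

Lemma powR_div (a c r : R) : 0 <= a -> 0 <= c ->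
  (a / c) `^ r = a `^ r * (c `^ r)^-1.
Proof.
move=> a0 c0; rewrite powRM ?invr_ge0//; congr (_ * _).
by rewrite -powR_inv1 // powRAC powR_inv1 // powR_ge0.
Qed.

(** On [x >= z / 2] the factor [|x| / (1 + z)] absorbs the ratio, which is at
    most one; on [x < z / 2] the ratio is exponentially small in [z]. *)
Lemma tail_ratio_envelope (z x : R) : 0 <= z ->
  tail_ratio k ak z x <= ((1 + z) `^ p)^-1 * (A * (`|x| + q)) `^ p.
Proof.
move=> z0; have q0 : 0 < q by apply: lt_le_trans q1.
have A0 : 0 <= A by rewrite (le_trans _ A2).
have x0 := normr_ge0 x.
have z1 : 0 <= 1 + z by rewrite addr_ge0.
have y0 : 0 <= A * (`|x| + q) by rewrite mulr_ge0// addr_ge0// ltW.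
rewrite mulrC -powR_div //.
have Aq : A * q <= A * (`|x| + q) by rewrite ler_wpM2l ?lerDr.
have [zx|xz] := leP (z / 2) x.
  apply: (le_trans (tail_ratio_le1 x z0)).
  have : 1 <= A * (`|x| + q) / (1 + z).
    rewrite ler_pdivlMr; last by lra.
    apply: (@le_trans _ _ (2 * (`|x| + q))).
      by have := ler_norm x; have := q1; lra.
    by rewrite ler_wpM2r ?A2 ?addr_ge0 ?(ltW q0).
  move=> h; apply: (le_trans h); exact: le1r_powR.
apply: (@le_trans _ _ (weight z / weight (z / 2))).
  rewrite ler_wpM2l ?(ltW (weight_gt0 _ _ _))//.
  rewrite lef_pV2 ?posrE ?weight_gt0//.
  apply: weight_nonincreasing => //; first by rewrite le_max lexx.
  rewrite ge_max; apply/andP; split; first by lra.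
  by rewrite ge_min (ltW xz).
apply: (le_trans (weight_ratio_le z0)).
apply: ge0_ler_powR; rewrite ?nnegrE ?(le_trans ler01 p1)//.
- by rewrite divr_ge0 // mulr_ge0 // ltW.
- by rewrite divr_ge0.
- by rewrite ler_wpM2r// invr_ge0.
Qed.

End envelope_bounds.

Lemma is_derive_measurable (R : realType) (f df : R -> R) :
  (forall x, is_derive x (1 : R) f (df x)) -> measurable_fun setT f.
Proof.
move=> hf; apply: continuous_measurable_fun => x.
apply: differentiable_continuous; apply/derivable1_diffP.
by have [] := hf x.
Qed.

(** The constant [C] of the envelope: [2 + 2 / ak] comes from
    [tail_ratio_envelope], one factor [2] from moving the argument of a bound by
    at most one, and the last factor dominates all constants multiplying the
    tail ratio. *)
Definition stein_const (R : realType) (k : nat) (ak b : R) : R :=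
  2 * (2 + 2 / ak) * (2 + (2 * b)^-1 + growth k ak b + 2 * k%:R * ak).

Section stein_const.
Context {R : realType}.
Variables (k : nat) (ak b p q : R).
Hypotheses (hk : (0 < k)%N) (hak : 0 < ak) (hb : 0 < b).
Hypotheses (p_ge : 2 * k%:R - 1 <= p) (q_ge1 : (1 : R) <= q)
  (pq : q ^+ (2 * k) = p).

Local Notation C := (stein_const k ak b).
Local Notation u := (envelope C q p).
Local Notation A := (2 + 2 / ak).

Let A2 : 2 <= A. Proof. by rewrite lerDl divr_ge0 ?(ltW hak). Qed.

Let p_ge1 : 1 <= p. Proof. exact: exponent_ge1 hk p_ge. Qed.

(** The four constants that the envelope has to absorb. *)
Lemma stein_const_ge (m : R) :
  [|| m == 2, m == (2 * b)^-1, m == growth k ak b | m == 2 * k%:R * ak] ->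
  0 <= m /\ 2 * A * m <= C.
Proof.
have r0 : 0 <= (2 * b)^-1 by rewrite invr_ge0 mulr_ge0 ?(ltW hb).
have g0 : 0 <= growth k ak b by exact: growth_ge0.
have c0 : 0 <= 2 * k%:R * ak by rewrite !mulr_ge0 ?(ltW hak).
have A0 : 0 <= 2 * A by rewrite mulr_ge0// (le_trans _ A2).
by move=> /or4P[] /eqP ->; (split; first by []);
  rewrite /stein_const ler_wpM2l//; lra.
Qed.

Lemma stein_const_ge2A : 2 * A * 2 <= C.
Proof. by have [] := @stein_const_ge 2; rewrite ?eqxx. Qed.

Let C0 : 0 <= C.
Proof.
apply: le_trans stein_const_ge2A.
by rewrite mulr_ge0// mulr_ge0// (le_trans _ A2).
Qed.

Let C8 : 8 <= C.
Proof. by apply: le_trans stein_const_ge2A; have := A2; lra. Qed.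

Let y_ge1 (x : R) : 1 <= `|x| + q.
Proof. by have := q_ge1; have := normr_ge0 x; lra. Qed.

Lemma envelopeN (x : R) : u (- x) = u x.
Proof. by rewrite /envelope normrN. Qed.

Lemma envelope_ge (x w : R) : 0 <= w -> w <= C * (`|x| + q) ->
  w `^ p <= u x.
Proof.
move=> w0 wle; apply: ge0_ler_powR; rewrite ?nnegrE//.
  by rewrite (le_trans ler01 p_ge1).
by rewrite (le_trans w0).
Qed.

Lemma envelope_ge_base (x : R) : C * (`|x| + q) <= u x.
Proof.
apply: le1r_powR; last exact: p_ge1.
have := y_ge1 x; have := C8; nra.
Qed.

Lemma envelope_ge1 (x : R) : 1 <= u x.
Proof.
apply: le_trans (envelope_ge_base x).
have := y_ge1 x; have := C8; nra.
Qed.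

Lemma normr_le_envelope (x : R) : `|x| <= u x.
Proof.
apply: le_trans (envelope_ge_base x).
have := y_ge1 x; have := C8; have := q_ge1; have := normr_ge0 x; nra.
Qed.

Lemma pow_le_powR (w : R) : 1 <= w -> w ^+ (2 * k - 1) <= w `^ p.
Proof.
move=> w1; rewrite -powR_mulrn ?(le_trans ler01)// ler_powR//.
by apply: le_trans p_ge; rewrite natrB ?muln_gt0// natrM.
Qed.

Lemma psi_le_envelope (x : R) : `|psi k ak x| <= u x.
Proof.
have [c0 cC] : 0 <= 2 * k%:R * ak /\ 2 * A * (2 * k%:R * ak) <= C.
  by apply: stein_const_ge; rewrite eqxx !orbT.
apply: (le_trans (normr_psi_le k hak x)).
have w1 := y_ge1 x.
apply: (@le_trans _ _ (2 * k%:R * ak * (`|x| + q) `^ p)).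
  rewrite ler_wpM2l //; apply: le_trans (pow_le_powR w1).
  by rewrite lerXn2r ?nnegrE ?addr_ge0 ?(le_trans ler01 q_ge1)// addrC lerD2l.
apply: scale_powR => //.
- by apply: le_trans cC; have := A2; nra.
- by have := C8; lra.
- by rewrite (le_trans ler01).
Qed.

(** The indicator of [|x| >= |z| - 2] is below the normalised envelope. *)
Lemma window_le_envelope (z x : R) : `|z| - 2 <= `|x| ->
  1 <= ((1 + `|z|) `^ p)^-1 * u x.
Proof.
move=> zx; have z1 : 0 <= 1 + `|z| by rewrite addr_ge0.
have zp : 0 < (1 + `|z|) `^ p by rewrite powR_gt0// ltr_wpDr.
rewrite mulrC ler_pdivlMr // mul1r envelope_ge//.
have := y_ge1 x; have := C8; have := q_ge1; have := normr_ge0 x; nra.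
Qed.

Lemma envelope_nondecreasing (t x : R) : `|t| <= `|x| -> u t <= u x.
Proof.
move=> tx; apply: envelope_ge; last by rewrite ler_wpM2l ?C0// lerD2r.
by rewrite mulr_ge0 ?C0// (le_trans ler01)// y_ge1.
Qed.

(** Each of the constants entering [stein_const] may multiply the [p]-th power
    of [A w], with [w <= 2 (|x| + q)], without exceeding the envelope. *)
Lemma scaled_powR_le_envelope (m x w : R) : 0 <= m -> 2 * A * m <= C ->
  0 <= w -> w <= 2 * (`|x| + q) -> m * (A * w) `^ p <= u x.
Proof.
move=> m0 mC w0 wle; have y1 := y_ge1 x.
have A0 : 0 < A by apply: lt_le_trans A2.
have A0' : 0 < 2 * A by rewrite mulr_gt0.
apply: (@le_trans _ _ (m * (2 * A * (`|x| + q)) `^ p)).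
  rewrite ler_wpM2l//; apply: ge0_ler_powR; rewrite ?nnegrE.
  - by rewrite (le_trans ler01 p_ge1).
  - by rewrite mulr_ge0// ltW.
  - by rewrite mulr_ge0 ?(ltW A0')// (le_trans ler01).
  - by rewrite mulrAC [leRHS]mulrC ler_pM2l.
have CE : C * (`|x| + q) = C / (2 * A) * (2 * A * (`|x| + q)).
  by rewrite [in RHS]mulrA divfK // gt_eqF.
rewrite /envelope CE; apply: scale_powR => //.
- by rewrite ler_pdivlMr // mulrC.
- by rewrite ler_pdivlMr // mul1r; have := stein_const_ge2A; lra.
- by rewrite mulr_ge0 ?(ltW A0')// (le_trans ler01).
Qed.

Lemma scaled_tail_ratio_le (m z x : R) : 0 <= z -> 0 <= m -> 2 * A * m <= C ->
  m * tail_ratio k ak z x <= ((1 + z) `^ p)^-1 * u x.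
Proof.
move=> z0 m0 mC; have y1 := y_ge1 x.
have h := tail_ratio_envelope hk hak p_ge q_ge1 pq x z0.
apply: le_trans (ler_wpM2l m0 h) _.
rewrite mulrCA ler_wpM2l ?invr_ge0 ?powR_ge0//.
by apply: scaled_powR_le_envelope => //; lra.
Qed.

(** The Lipschitz constant of [psi * sol] near [x] costs the square of the
    envelope: one factor for the tail ratio, one for the polynomial growth of
    [psi], which is where [2k - 1 <= p] is needed. *)
Lemma growth_tail_ratio_le (z x t : R) : 0 <= z -> `|t - x| <= 1 ->
  growth k ak b * (1 + `|t|) ^+ (2 * k - 1) * tail_ratio k ak z t
    <= ((1 + z) `^ p)^-1 * u x ^+ 2.
Proof.
move=> z0 tx; have y1 := y_ge1 x.
have tx1 : `|t| <= `|x| + 1.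
  by have := ler_normD x (t - x); rewrite addrC subrK; lra.
have [g0 gC] : 0 <= growth k ak b /\ 2 * A * growth k ak b <= C.
  by apply: stein_const_ge; rewrite eqxx !orbT.
have h := tail_ratio_envelope hk hak p_ge q_ge1 pq t z0.
have hT : (1 + `|t|) ^+ (2 * k - 1) <= u x.
  apply: (@le_trans _ _ ((1 + `|t|) `^ p)).
    by apply: pow_le_powR; rewrite lerDl.
  apply: envelope_ge; first by rewrite addr_ge0.
  by have := C8; have := q_ge1; have := normr_ge0 x; nra.
have hg : growth k ak b * (A * (`|t| + q)) `^ p <= u x.
  apply: scaled_powR_le_envelope => //; last by have := q_ge1; lra.
  by rewrite addr_ge0// (le_trans ler01).
have kap0 : 0 <= ((1 + z) `^ p)^-1 by rewrite invr_ge0 powR_ge0.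
set kap := _^-1 in h kap0 *; set T := _ ^+ (2 * k - 1) in hT *.
have T0 : 0 <= T by rewrite exprn_ge0// addr_ge0.
set P := _ `^ p in h hg *.
have P0 : 0 <= P by rewrite powR_ge0.
have u0 : 0 <= u x by rewrite powR_ge0.
apply: (@le_trans _ _ (growth k ak b * T * (kap * P))).
  by rewrite ler_wpM2l// mulr_ge0.
have -> : growth k ak b * T * (kap * P) = kap * (T * (growth k ak b * P)).
  by ring.
by rewrite ler_wpM2l// expr2 ler_pM// mulr_ge0.
Qed.

End stein_const.

Section stein_pair_exists.
Context {R : realType}.
Variables (k : nat) (ak b p q : R) (F : R -> R).
Hypotheses (hk : (0 < k)%N) (hak : 0 < ak) (hb : 0 < b).
Hypotheses (p_ge : 2 * k%:R - 1 <= p) (q_ge1 : (1 : R) <= q)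
  (pq : q ^+ (2 * k) = p).
Hypothesis hF : forall x : R, is_derive x (1 : R) F (b * weight k ak x).
Hypothesis F_ge0 : forall x, 0 <= F x.
Hypothesis F_le1 : forall x, F x <= 1.
Hypothesis F_sym : forall x, F (- x) = 1 - F x.
Hypothesis F_lim : forall eps : R, 0 < eps ->
  exists t0, forall t, t0 <= t -> 1 - F t <= eps.

Local Notation C := (stein_const k ak b).
Local Notation u := (envelope C q p).

Lemma sol_measurable (z : R) : measurable_fun setT (sol k ak b F z).
Proof.
rewrite /sol; apply: measurable_fun_ifT.
- by apply: measurable_fun_ler => //; exact: measurable_cst.
- exact: (is_derive_measurable (is_derive_solL hk hb hF z)).
- exact: (is_derive_measurable (is_derive_solR hb hF z)).
Qed.

Lemma dsol_measurable (z : R) (s : bool) :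
  measurable_fun setT (dsol k ak b F z s).
Proof.
apply: measurable_funB; last exact: measurable_cst.
apply: measurable_funD.
  apply: measurable_funM; last exact: sol_measurable.
  exact: (is_derive_measurable (is_derive_psi k ak)).
have mb : measurable_fun setT (fun x : R => if s then x <= z else x < z).
  by case: s; [apply: measurable_fun_ler|apply: measurable_fun_ltr] => //;
    exact: measurable_cst.
have -> : step z s = fun x => if (if s then x <= z else x < z) then 1 else 0.
  by apply/funext => x; rewrite /step; case: (if s then _ else _).
by apply: measurable_fun_ifT => //; exact: measurable_cst.
Qed.

Lemma stein_pair_nonneg (z : R) (s : bool) : 0 <= z ->
  stein_pair (psi k ak) (step z s) (F z) z ((1 + z) `^ p)^-1 u
    (sol k ak b F z) (dsol k ak b F z s).
Proof.
move=> z0.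
have str := @scaled_tail_ratio_le _ k ak b p q hk hak hb p_ge q_ge1 pq.
have sc := @stein_const_ge R k ak b hak hb.
have [_ s2] : 0 <= (2 : R) /\ 2 * (2 + 2 / ak) * 2 <= C.
  by apply: sc; rewrite eqxx.
have [r0 sr] : 0 <= (2 * b)^-1 /\ 2 * (2 + 2 / ak) * (2 * b)^-1 <= C.
  by apply: sc; rewrite eqxx orbT.
have rho0 x := tail_ratio_gt0 k ak z x.
have rho1 x := tail_ratio_le1 k hak x z0.
have solb x := sol_le hk hak hb hF F_ge0 F_le1 F_sym F_lim z0 x.
have sol0 x := sol_ge0 k ak hb F_ge0 F_le1 z x.
have dsolb x := normr_dsol_le hk hak hb hF F_ge0 F_le1 F_sym F_lim s z0 x.
have u0 x : 0 <= u x by exact: powR_ge0.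
have kap0 : 0 <= ((1 + z) `^ p)^-1 by rewrite invr_ge0 powR_ge0.
have rho_u x : 2 * tail_ratio k ak z x <= ((1 + z) `^ p)^-1 * u x.
  exact: str.
split=> [x|x|x|x|x y|x y xy|||].
- by rewrite /dsol; ring.
- apply: le_trans (rho_u x).
  have := normr_step_sub_le hk hak hb hF F_ge0 F_le1 F_sym F_lim s z0 x.
  by have := rho0 x; lra.
- by rewrite ger0_norm // (le_trans (solb x))// str.
- exact: le_trans (rho_u x).
- set M := _ * (_ + _); have -> : `|x - y| * M = 2 * (M / 2) * `|x - y|.
    by field.
  apply: (sol_lipschitz hk hak hb hF F_ge0 F_le1 F_sym F_lim z0) => t ht.
  rewrite ler_pdivlMr // mulrC (le_trans (rho_u t))// /M ler_wpM2l//.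
  have mono := @envelope_nondecreasing _ k ak b p q hk hak hb p_ge q_ge1.
  have [tx|xt] := leP `|t| `|x|.
    by rewrite (le_trans (mono _ _ tx))// lerDl.
  have ty : `|t| <= `|y|.
    move: xt ht; have [xy|yx] := leP x y => xt /andP[h1 h2].
      rewrite (@ger0_norm _ t); last first.
        by rewrite leNgt; apply/negP => t0; move: xt; rewrite !ltr0_norm; lra.
      by rewrite (le_trans h2)// ler_norm.
    rewrite (@ler0_norm _ t); last first.
      by rewrite leNgt; apply/negP => t0; move: xt; rewrite !gtr0_norm; lra.
    by rewrite -normrN; apply: le_trans (ler_norm _); lra.
  by rewrite (le_trans (mono _ _ ty))// lerDr.
- apply: (sol_taylor hk hak hb hF F_ge0 F_le1 F_sym F_lim s z0) => t ht.
  apply: (growth_tail_ratio_le hk hak hb p_ge q_ge1 pq z0).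
  exact: le_trans (between_dist ht) xy.
- exists (2 + (2 * b)^-1) => x; have := rho1 x; have := rho0 x.
  have := solb x; have := sol0 x; have := dsolb x; split; last by lra.
  by rewrite ger0_norm //; nra.
- exact: sol_measurable.
- exact: dsol_measurable.
Qed.

(** Negative [z] is reduced to [- z] by reflection; the point [z] itself then
    changes side, which is why [step] carries a boolean. *)
Lemma stein_pair_exists (z : R) : exists f df : R -> R,
  stein_pair (psi k ak) (fun x => (x <= z)%R%:R) (F z) z
    ((1 + `|z|) `^ p)^-1 u f df.
Proof.
have [z0|z0] := leP 0 z.
  exists (sol k ak b F z), (dsol k ak b F z true); rewrite ger0_norm//.
  exact: (@stein_pair_nonneg z true).
have nz0 : 0 <= - z by lra.
have := stein_pair_reflect (psiN ak hk) (envelopeN k ak b p q)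
  (stein_pair_nonneg false nz0).
rewrite F_sym opprB addrCA subrr addr0 opprK => h; rewrite ltr0_norm//.
exists (fun x => sol k ak b F (- z) (- x)),
  (fun x => - dsol k ak b F (- z) false (- x)).
have -> // : (fun x : R => (x <= z)%R%:R) =
  (fun x => 1 - step (- z) false (- x)) :> (R -> R).
apply/funext => x; rewrite /step ltrN2 ltNge.
by case: (x <= z); rewrite /= ?subr0 ?subrr.
Qed.

End stein_pair_exists.

(** * Expectations of real random variables *)

Lemma measurable_natr_bool (R : realType) d (T : measurableType d)
    (t : T -> bool) : measurable_fun setT t ->
  measurable_fun setT (fun w => (t w)%:R : R).
Proof.
move=> mt; have -> : (fun w => (t w)%:R) = (fun w => if t w then 1 else 0)
    :> (T -> R) by apply/funext => w; case: (t w).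
by apply: measurable_fun_ifT => //; exact: measurable_cst.
Qed.

Section expectation_toolbox.
Context {R : realType} d {T : measurableType d} (P : probability T R).
Implicit Types X Y : T -> R.

Local Notation L1 X := (P.-integrable setT (EFin \o X)).
Local Notation E X := (Rintegral P setT X).

Lemma integrable_measurable X : L1 X -> measurable_fun setT X.
Proof. by move=> /integrableP[/measurable_EFinP]. Qed.

Lemma dominated_integrable X Y : measurable_fun setT X ->
  (forall w, `|X w| <= Y w) -> L1 Y -> L1 X.
Proof.
move=> mX XY; apply: le_integrable => //; first exact/measurable_EFinP.
move=> w _ /=; rewrite lee_fin; apply: le_trans (XY w) _; exact: ler_norm.
Qed.

Lemma integrable_add X Y : L1 X -> L1 Y -> L1 (fun w => X w + Y w).
Proof. by move=> iX iY; exact: (integrableD measurableT iX iY). Qed.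

Lemma integrable_sub X Y : L1 X -> L1 Y -> L1 (fun w => X w - Y w).
Proof. by move=> iX iY; exact: (integrableB measurableT iX iY). Qed.

Lemma integrable_scale (c : R) X : L1 X -> L1 (fun w => c * X w).
Proof. by move=> iX; exact: (integrableZl measurableT c iX). Qed.

Lemma integrable_abs X : L1 X -> L1 (fun w => `|X w|).
Proof. exact: integrable_norm. Qed.

Lemma integrable_const (c : R) : L1 (fun=> c).
Proof. by apply: finite_measure_integrable_cst. Qed.

Lemma integrable_bounded_mul (K : R) X Y : measurable_fun setT X ->
  (forall w, `|X w| <= K) -> L1 Y -> L1 (fun w => X w * Y w).
Proof.
move=> mX XK iY.
apply: (@dominated_integrable _ (fun w => K * `|Y w|)).
- by apply: measurable_funM => //; exact: integrable_measurable.
- by move=> w; rewrite normrM ler_wpM2r.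
- exact/integrable_scale/integrable_abs.
Qed.

Lemma integrable_mul_sqr X Y : measurable_fun setT X -> measurable_fun setT Y ->
  L1 (fun w => X w ^+ 2) -> L1 (fun w => Y w ^+ 2) -> L1 (fun w => X w * Y w).
Proof.
move=> mX mY iX iY.
apply: (@dominated_integrable _ (fun w => X w ^+ 2 + Y w ^+ 2)).
- exact: measurable_funM.
- move=> w; rewrite -(real_normK (num_real (X w))).
  rewrite -(real_normK (num_real (Y w))).
  rewrite normrM; have := normr_ge0 (X w); have := normr_ge0 (Y w).
  by set x := `|_|; set y := `|_|; nra.
- exact: integrable_add.
Qed.

Lemma expect_add X Y : L1 X -> L1 Y -> E (fun w => X w + Y w) = E X + E Y.
Proof. exact: RintegralD. Qed.

Lemma expect_sub X Y : L1 X -> L1 Y -> E (fun w => X w - Y w) = E X - E Y.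
Proof. exact: RintegralB. Qed.

Lemma expect_scale (c : R) X : L1 X -> E (fun w => c * X w) = c * E X.
Proof. exact: RintegralZl. Qed.

Lemma expect_const (c : R) : E (fun=> c) = c.
Proof.
have h : fine (P setT) = 1 by rewrite probability_setT.
by rewrite Rintegral_cst// h mulr1.
Qed.

Lemma expect_le X Y : L1 X -> L1 Y -> (forall w, X w <= Y w) -> E X <= E Y.
Proof. by move=> iX iY XY; apply: le_Rintegral. Qed.

Lemma expect_abs X : L1 X -> `|E X| <= E (fun w => `|X w|).
Proof. exact: le_normr_Rintegral. Qed.

Lemma expect_abs_le X Y : L1 X -> L1 Y -> (forall w, `|X w| <= Y w) ->
  `|E X| <= E Y.
Proof.
move=> iX iY XY; apply: le_trans (expect_abs iX) _.
by apply: expect_le => //; exact: integrable_abs.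
Qed.

(** Cauchy-Schwarz for a factor [Y] whose second moment is at least one: the
    square root of that moment may then be replaced by the moment itself. *)
Lemma expect_abs_mul_le X Y : measurable_fun setT X -> measurable_fun setT Y ->
  (forall w, 0 <= Y w) ->
  L1 (fun w => X w ^+ 2) -> L1 (fun w => Y w ^+ 2) ->
  1 <= E (fun w => Y w ^+ 2) ->
  E (fun w => Y w * `|X w|) <=
    Num.sqrt (E (fun w => X w ^+ 2)) * E (fun w => Y w ^+ 2).
Proof.
move=> mX mY Y0 iX iY.
set al := E (fun w => X w ^+ 2); set be := E (fun w => Y w ^+ 2) => be1.
have al0 : 0 <= al by apply: Rintegral_ge0 => w _; exact: sqr_ge0.
have mXn : measurable_fun setT (fun w => `|X w|) by exact: measurableT_comp.
have iXn : L1 (fun w => `|X w| ^+ 2).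
  by under eq_fun do rewrite real_normK ?num_real//.
have iXY : L1 (fun w => Y w * `|X w|) by exact: integrable_mul_sqr.
set e := E (fun w => Y w * `|X w|).
(* the arithmetic-geometric inequality with a free weight *)
have amgm (t : R) : 0 < t -> e <= t / 2 * al + t^-1 / 2 * be.
  move=> t0; rewrite -expect_scale// -expect_scale// -expect_add; last 2 first.
    exact: integrable_scale.
    exact: integrable_scale.
  apply: expect_le => //.
    by apply: integrable_add; exact: integrable_scale.
  move=> w; rewrite -(real_normK (num_real (X w))).
  set x := `|X w|; set y := Y w.
  rewrite -subr_ge0.
  have -> : t / 2 * x ^+ 2 + t^-1 / 2 * y ^+ 2 - y * x
    = (t / 2) * (x - t^-1 * y) ^+ 2 by field; rewrite gt_eqF.
  by rewrite mulr_ge0 ?sqr_ge0// divr_ge0// ltW.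
have [al_le0|al_gt0] := leP al 0.
  have -> : al = 0 by apply/eqP; rewrite eq_le al_le0.
  rewrite sqrtr0 mul0r leNgt; apply/negP => e0.
  have al_eq0 : al = 0 by apply/eqP; rewrite eq_le al_le0.
  (* the weight [be / e] turns [amgm] into [e <= e / 2] *)
  have t0 : 0 < be / e by rewrite divr_gt0// (lt_le_trans ltr01).
  have := amgm _ t0; rewrite al_eq0 mulr0 add0r invf_div.
  have -> : e / be / 2 * be = e / 2.
    by field; rewrite gt_eqF// (lt_le_trans ltr01).
  lra.
set s := Num.sqrt al; have s0 : 0 < s by rewrite sqrtr_gt0.
have sE : al = s ^+ 2 by rewrite sqr_sqrtr.
have si0 : 0 < s^-1 by rewrite invr_gt0.
apply: le_trans (amgm _ si0) _; rewrite sE invrK.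
have -> : s^-1 / 2 * s ^+ 2 + s / 2 * be = s / 2 * (1 + be).
  by field; rewrite gt_eqF.
have -> : s * be = s / 2 * (be + be) by field.
by rewrite ler_wpM2l ?lerD2r// divr_ge0// ltW.
Qed.

End expectation_toolbox.

(** * Exchangeable pairs *)

Section exchangeable_pair.
Context {R : realType} d {T : measurableType d} (P : probability T R).
Variables W W' : T -> R.
Hypotheses (mW : measurable_fun setT W) (mW' : measurable_fun setT W').
Hypothesis exch : forall A : set (R * R), measurable A ->
  pushforward P (fun w => (W w, W' w)) A =
  pushforward P (fun w => (W' w, W w)) A.

Local Notation L1 X := (P.-integrable setT (EFin \o X)).
Local Notation E X := (Rintegral P setT X).

Let mWW' : measurable_fun setT (fun w => (W w, W' w)).
Proof. exact: measurable_fun_pair. Qed.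

Let mW'W : measurable_fun setT (fun w => (W' w, W w)).
Proof. exact: measurable_fun_pair. Qed.

Lemma exchange_ge0 (G : R * R -> \bar R) : measurable_fun setT G ->
  (forall y, (0 <= G y)%E) ->
  (\int[P]_w G (W w, W' w) = \int[P]_w G (W' w, W w))%E.
Proof.
move=> mG G0.
have h1 := @ge0_integral_pushforward _ _ _ _ R _ mWW' P setT G measurableT mG
  (fun y _ => G0 y).
have h2 := @ge0_integral_pushforward _ _ _ _ R _ mW'W P setT G measurableT mG
  (fun y _ => G0 y).
rewrite preimage_setT in h1; rewrite preimage_setT in h2.
rewrite -[LHS]h1 -[RHS]h2; apply: eq_measure_integral => A mA _.
exact: exch.
Qed.

Lemma exchange_integrable (G : R * R -> R) : measurable_fun setT G ->
  L1 (fun w => G (W w, W' w)) -> L1 (fun w => G (W' w, W w)).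
Proof.
move=> mG /integrableP[_ h]; apply/integrableP; split.
  by apply/measurable_EFinP; exact: measurableT_comp mW'W.
apply: le_lt_trans h; rewrite (exchange_ge0 (G := fun y => `|(G y)%:E|%E))//.
by apply: measurableT_comp => //; exact/measurable_EFinP.
Qed.

Lemma exchange_expect (G : R * R -> R) : measurable_fun setT G ->
  L1 (fun w => G (W w, W' w)) ->
  E (fun w => G (W w, W' w)) = E (fun w => G (W' w, W w)).
Proof.
move=> mG iG; congr fine.
have mG' : measurable_fun setT (EFin \o G) by exact/measurable_EFinP.
have iG' := exchange_integrable mG iG.
have h1 := @integral_pushforward _ _ _ _ R _ mWW' P setT _ mG'.
have h2 := @integral_pushforward _ _ _ _ R _ mW'W P setT _ mG'.
rewrite preimage_setT in h1; rewrite preimage_setT in h2.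
rewrite -[LHS](h1 iG measurableT) -[RHS](h2 iG' measurableT).
apply: eq_measure_integral => A mA _; exact: exch.
Qed.

(** Antisymmetrisation: [E (W - W') g(W') = - E (W - W') g(W)]. *)
Lemma exchange_antisymmetric (g : R -> R) (K : R) : measurable_fun setT g ->
  (forall x, `|g x| <= K) -> L1 (fun w => W w - W' w) ->
  E (fun w => (W w - W' w) * (g (W w) - g (W' w))) =
    2 * E (fun w => g (W w) * (W w - W' w)).
Proof.
move=> mg gK iD.
have i1 : L1 (fun w => g (W w) * (W w - W' w)).
  by apply: (@integrable_bounded_mul _ _ _ _ K) => //; exact: measurableT_comp.
have mG : measurable_fun setT (fun y : R * R => g y.1 * (y.1 - y.2)).
  apply: measurable_funM; first exact: measurableT_comp.
  exact: measurable_funB.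
have i2 := exchange_integrable mG i1; have e2 := exchange_expect mG i1.
rewrite /= in i2 e2.
transitivity (E (fun w => g (W w) * (W w - W' w) + g (W' w) * (W' w - W w))).
  by apply: eq_Rintegral => w _; ring.
by rewrite expect_add// -e2; ring.
Qed.

End exchangeable_pair.

(** * The nonuniform bound under finite moments *)

(** The truncation of [x] to the interval from [z - 2 a] to [z + 2 a], shifted
    so as to vanish at the origin.  It has slope one on the window around [z]
    and, if [a <= 1], it vanishes on [|x| < |z| - 2], whatever the sign of
    [z]. *)
Definition clamp (R : realType) (z a x : R) : R :=
  Num.min (Num.max x (z - 2 * a)) (z + 2 * a)
  - Num.min (Num.max 0 (z - 2 * a)) (z + 2 * a).

Section clamp.
Context {R : realType}.
Variables (z a : R).
Hypotheses (a0 : 0 < a) (a1 : a <= 1).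

Local Notation g := (clamp z a).

Lemma clamp_measurable : measurable_fun setT g.
Proof.
apply: measurable_funB; last exact: measurable_cst.
apply: measurable_minr; last exact: measurable_cst.
by apply: measurable_maxr => //; exact: measurable_cst.
Qed.

Lemma normr_clamp_le (x : R) : `|g x| <= 4 * a.
Proof.
have ha := a0.
have mm (t : R) : z - 2 * a <= Num.min (Num.max t (z - 2 * a)) (z + 2 * a)
    <= z + 2 * a.
  by rewrite le_min le_max lexx orbT ge_min lexx orbT andbT /=; lra.
by rewrite ler_norml /clamp; have := mm x; have := mm 0; lra.
Qed.

Lemma clamp_eq0 (x : R) : `|x| < `|z| - 2 -> g x = 0.
Proof.
have ha := a0; have hb := a1; rewrite ltr_norml /clamp => /andP[].
have [z0|z0] := leP 0 z.
  rewrite (ger0_norm z0) => h1 h2.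
  by rewrite (max_idPr _) ?(max_idPr _); [ring|lra|lra].
rewrite (ltr0_norm z0) => h1 h2.
have mx (t : R) : z + 2 * a <= t ->
    Num.min (Num.max t (z - 2 * a)) (z + 2 * a) = z + 2 * a.
  by move=> ht; apply/min_idPr; rewrite le_max ht.
by rewrite !mx ?subrr//; lra.
Qed.

Lemma clamp_monotone (x y : R) : 0 <= (x - y) * (g x - g y).
Proof.
wlog xy : x y / x <= y => [hw|].
  have [xy|yx] := orP (le_total x y); first exact: hw.
  by have := hw y x yx; rewrite -mulrNN (opprB y) (opprB (g y)).
rewrite -mulrNN (opprB x) (opprB (g x)) mulr_ge0 ?subr_ge0// /clamp lerD2r.
rewrite le_min !ge_min lexx orbT andbT.
by rewrite ge_max !le_max xy lexx !orbT.
Qed.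

Lemma clamp_window (x y : R) : `|x - z| <= a -> `|x - y| <= a ->
  (x - y) * (g x - g y) = (x - y) ^+ 2.
Proof.
have ha := a0; rewrite !ler_norml /clamp => /andP[h1 h2] /andP[h3 h4].
have mx (t : R) : z - 2 * a <= t -> t <= z + 2 * a ->
    Num.min (Num.max t (z - 2 * a)) (z + 2 * a) = t.
  by move=> t1 t2; rewrite (max_idPl t1) (min_idPl t2).
by rewrite (mx x) ?(mx y); [ring|lra|lra|lra|lra].
Qed.

End clamp.

Section nonuniform_bound.
Context {R : realType} d {T : measurableType d} (P : probability T R).
Variables W W' Rm c : T -> R.
Hypotheses (mW : measurable_fun setT W) (mW' : measurable_fun setT W')
  (mR : measurable_fun setT Rm) (mc : measurable_fun setT c).
Hypothesis exch : forall A : set (R * R), measurable A ->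
  pushforward P (fun w => (W w, W' w)) A =
  pushforward P (fun w => (W' w, W w)) A.

Local Notation L1 X := (P.-integrable setT (EFin \o X)).
Local Notation E X := (Rintegral P setT X).

Variables (psi h u f df : R -> R) (c0 z kap lam a : R).
Hypotheses (mpsi : measurable_fun setT psi) (mh : measurable_fun setT h)
  (mu : measurable_fun setT u).
Hypothesis sp : stein_pair psi h c0 z kap u f df.
Hypotheses (kap_ge0 : 0 <= kap) (lam_gt0 : 0 < lam) (a_gt0 : 0 < a).
Hypotheses (u_ge1 : forall x, 1 <= u x) (u_ge : forall x, `|x| <= u x)
  (u_psi : forall x, `|psi x| <= u x)
  (u_window : forall x, `|z| - 2 <= `|x| -> 1 <= kap * u x).

Local Notation Delta w := (W w - W' w).
Local Notation tailD w := (Delta w ^+ 2 * (a < `|Delta w|)%R%:R).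

Hypothesis iu : L1 (fun w => u (W w) ^+ 2).
Hypothesis iR : L1 (fun w => Rm w ^+ 2).
Hypothesis ic : L1 (fun w => (1 - (2 * lam)^-1 * c w) ^+ 2).
Hypothesis iD : L1 (fun w => tailD w ^+ 2).

(** The two conditional-expectation identities, tested against bounded
    functions of [W]. *)
Hypothesis regression : forall (g : R -> R) (K : R), measurable_fun setT g ->
  (forall x, `|g x| <= K) ->
  E (fun w => g (W w) * Delta w) =
  E (fun w => g (W w) * (lam * psi (W w) - Rm w)).
Hypothesis variance_id : forall (g : R -> R) (K : R), measurable_fun setT g ->
  (forall x, `|g x| <= K) ->
  E (fun w => g (W w) * Delta w ^+ 2) = E (fun w => g (W w) * c w).

Local Notation V := (E (fun w => u (W w) ^+ 2)).
Local Notation S1 := (Num.sqrt (E (fun w => (1 - (2 * lam)^-1 * c w) ^+ 2))).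
Local Notation SR := (Num.sqrt (E (fun w => Rm w ^+ 2))).
Local Notation SD := (Num.sqrt (E (fun w => tailD w ^+ 2))).

Let muW : measurable_fun setT (fun w => u (W w)).
Proof. exact: measurableT_comp. Qed.

Let muW' : measurable_fun setT (fun w => u (W' w)).
Proof. exact: measurableT_comp. Qed.

Let u0 x : 0 <= u x. Proof. exact: le_trans ler01 (u_ge1 x). Qed.

Let le_usqr x : u x <= u x ^+ 2.
Proof. by rewrite expr2 ler_peMl. Qed.

Lemma envelope_sqr_integrable : L1 (fun w => u (W' w) ^+ 2).
Proof.
apply: (exchange_integrable mW mW' exch (G := fun y => u y.1 ^+ 2)) => //.
by apply: measurable_funX; exact: measurableT_comp.
Qed.

Let V' : E (fun w => u (W' w) ^+ 2) = V.
Proof.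
symmetry; apply: (exchange_expect mW mW' exch (G := fun y => u y.1 ^+ 2)) => //.
by apply: measurable_funX; exact: measurableT_comp.
Qed.

Lemma fst_integrable : L1 W.
Proof.
apply: dominated_integrable mW _ iu => w.
exact: le_trans (u_ge _) (le_usqr _).
Qed.

Lemma snd_integrable : L1 W'.
Proof.
apply: dominated_integrable mW' _ envelope_sqr_integrable => w.
exact: le_trans (u_ge _) (le_usqr _).
Qed.

Let iu' := envelope_sqr_integrable.
Let iW := fst_integrable.
Let iW' := snd_integrable.

Let iDelta : L1 (fun w => Delta w). Proof. exact: integrable_sub. Qed.

Lemma drift_integrable : L1 (fun w => psi (W w)).
Proof.
apply: dominated_integrable _ _ iu; first exact: measurableT_comp.
by move=> w; exact: le_trans (u_psi _) (le_usqr _).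
Qed.

Let integrable_of_sqr (X : T -> R) :
  measurable_fun setT X -> L1 (fun w => X w ^+ 2) -> L1 X.
Proof.
move=> mX iX.
have : L1 (fun w => X w * 1).
  apply: (integrable_mul_sqr (Y := fun=> 1)) => //.
  by under eq_fun do rewrite expr1n; exact: integrable_const.
by under eq_fun do rewrite mulr1.
Qed.

Let iRm : L1 Rm. Proof. exact: integrable_of_sqr. Qed.

Let icc : L1 (fun w => 1 - (2 * lam)^-1 * c w).
Proof.
apply: integrable_of_sqr => //; apply: measurable_funB => //.
exact: measurable_funM.
Qed.

Let ic1 : L1 c.
Proof.
have h2 : 2 * lam != 0 by rewrite gt_eqF// mulr_gt0.
have -> : c = fun w => (2 * lam) * (1 - (1 - (2 * lam)^-1 * c w)).
  by apply/funext => w; rewrite opprB addrCA subrr addr0 mulrA divff// mul1r.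
apply: integrable_scale; apply: integrable_sub => //.
exact: integrable_const.
Qed.

Lemma jump_sqr_integrable : L1 (fun w => Delta w ^+ 2).
Proof.
apply: (@dominated_integrable _ _ _ _ _
  (fun w => 2 * (u (W w) ^+ 2) + 2 * (u (W' w) ^+ 2))).
- by apply: measurable_funX; exact: measurable_funB.
- move=> w; rewrite ger0_norm ?sqr_ge0//.
  rewrite -(real_normK (num_real (W w - W' w))).
  have h1 := ler_normB (W w) (W' w); have h2 := u_ge (W w).
  have h3 := u_ge (W' w); have h4 := normr_ge0 (W w - W' w).
  move: h1 h2 h3 h4; move: (`|_ - _|) (`|W w|) (`|W' w|) (u _) (u _).
  by move=> D x y v v' *; have : 0 <= (v - v') ^+ 2 by [exact: sqr_ge0]; nra.
- by apply: integrable_add; exact: integrable_scale.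
Qed.

Let ipsi := drift_integrable.
Let iDelta2 := jump_sqr_integrable.

Let V_ge1 : 1 <= V.
Proof.
rewrite -[leLHS](expect_const P); apply: expect_le => //.
  exact: integrable_const.
by move=> w; rewrite -[leLHS](expr1n _ 2) lerXn2r ?nnegrE.
Qed.

(** This bound suffices when [a >= 1]. *)
Lemma trivial_bound : `|E (fun w => h (W w)) - c0| <= kap * V.
Proof.
have mhW : measurable_fun setT (fun w => h (W w)) by exact: measurableT_comp.
have dom w : `|h (W w) - c0| <= kap * u (W w) ^+ 2.
  by rewrite (le_trans (stein_rhs_le sp _))// ler_wpM2l.
have id : L1 (fun w => h (W w) - c0).
  apply: (dominated_integrable _ dom); last exact: integrable_scale.
  exact: measurable_funB.
have ih : L1 (fun w => h (W w)).
  have -> : (fun w => h (W w)) = fun w => (h (W w) - c0) + c0.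
    by apply/funext => w; rewrite subrK.
  by apply: integrable_add => //; exact: integrable_const.
rewrite -[X in _ - X](expect_const P) -expect_sub//; last first.
  exact: integrable_const.
rewrite -expect_scale//; apply: expect_abs_le => //.
exact: integrable_scale.
Qed.

Let mf : measurable_fun setT (fun w => f (W w)).
Proof. by apply: measurableT_comp => //; exact: stein_measurable sp. Qed.

Let mdf : measurable_fun setT (fun w => df (W w)).
Proof. by apply: measurableT_comp => //; exact: stein_dmeasurable sp. Qed.

(** The identity from which the bound is read off: by the Stein equation and
    exchangeability, only three error terms are left. *)
Lemma stein_decomposition :
  E (fun w => h (W w)) - c0 =
    E (fun w => df (W w) * (1 - (2 * lam)^-1 * c w))
    - lam^-1 * E (fun w => f (W w) * Rm w)
    + (2 * lam)^-1 * E (fun w => df (W w) * Delta w ^+ 2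
        - Delta w * (f (W w) - f (W' w))).
Proof.
have [K hK] := stein_bounded sp.
have fK x : `|f x| <= K by have [] := hK x.
have dfK x : `|df x| <= K by have [] := hK x.
have sf := stein_measurable sp; have sdf := stein_dmeasurable sp.
have bdf (X : T -> R) : L1 X -> L1 (fun w => df (W w) * X w).
  by apply: (@integrable_bounded_mul _ _ _ _ K).
have bf (X : T -> R) : L1 X -> L1 (fun w => f (W w) * X w).
  by apply: (@integrable_bounded_mul _ _ _ _ K).
have idf : L1 (fun w => df (W w)).
  by have := bdf _ (integrable_const P 1); under eq_fun do rewrite mulr1.
have eh : E (fun w => h (W w)) - c0 =
    E (fun w => df (W w)) - E (fun w => f (W w) * psi (W w)).
  have i3 : L1 (fun w => df (W w) - f (W w) * psi (W w)).
    by apply: integrable_sub => //; exact: bf.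
  have hE w : h (W w) = df (W w) - f (W w) * psi (W w) + c0.
    by have := stein_equation sp (W w); rewrite (mulrC (f _)); lra.
  have -> : E (fun w => h (W w)) =
      E (fun w => df (W w) - f (W w) * psi (W w) + c0).
    by apply: eq_Rintegral => w _; exact: hE.
  rewrite expect_add //; last exact: integrable_const.
  by rewrite expect_const addrK expect_sub //; exact: bf.
have e1 : E (fun w => df (W w) * (1 - (2 * lam)^-1 * c w)) =
    E (fun w => df (W w)) - (2 * lam)^-1 * E (fun w => df (W w) * Delta w ^+ 2).
  rewrite (variance_id sdf dfK) -expect_scale; last exact: bdf.
  rewrite -expect_sub //; last by apply: integrable_scale; exact: bdf.
  by apply: eq_Rintegral => w _; ring.
have e2 : E (fun w => f (W w) * Delta w) =
    lam * E (fun w => f (W w) * psi (W w)) - E (fun w => f (W w) * Rm w).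
  rewrite (regression sf fK) -expect_scale; last exact: bf.
  rewrite -expect_sub //; last 2 first.
  - by apply: integrable_scale; exact: bf.
  - exact: bf.
  by apply: eq_Rintegral => w _; ring.
have i4 : L1 (fun w => Delta w * (f (W w) - f (W' w))).
  apply: (@dominated_integrable _ _ _ _ _ (fun w => 2 * K * `|Delta w|)).
  - apply: measurable_funM; first exact: measurable_funB.
    by apply: measurable_funB => //; exact: measurableT_comp.
  - move=> w; rewrite normrM mulrC ler_wpM2r//.
    by rewrite (le_trans (ler_normB _ _))// mulr_natl mulr2n lerD.
  - by apply: integrable_scale; exact: integrable_abs.
have e3 := exchange_antisymmetric mW mW' exch sf fK iDelta.
rewrite eh e1 expect_sub //; last exact: bdf.
by rewrite e3 e2; field; rewrite gt_eqF.
Qed.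

Let mtailD : measurable_fun setT (fun w => tailD w).
Proof.
have mD : measurable_fun setT (fun w => Delta w) by exact: measurable_funB.
apply: measurable_funM; first exact: measurable_funX.
apply: measurable_natr_bool; apply: measurable_fun_ltr.
  exact: measurable_cst.
exact: measurableT_comp.
Qed.

Let tailD_ge0 w : 0 <= tailD w.
Proof. by rewrite mulr_ge0 ?sqr_ge0. Qed.

(** The mean of [g(W) X] is at most [K V] times the second-moment norm of [X]
    as soon as [|g| <= K u]. *)
Let weighted_le (K : R) (g : R -> R) (X : T -> R) : 0 <= K ->
  measurable_fun setT g ->
  (forall x, `|g x| <= K * u x) -> measurable_fun setT X ->
  L1 (fun w => X w ^+ 2) ->
  `|E (fun w => g (W w) * X w)|
    <= K * V * Num.sqrt (E (fun w => X w ^+ 2)).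
Proof.
move=> K0 mg gu mX iX.
have iuX : L1 (fun w => u (W w) * `|X w|).
  apply: integrable_mul_sqr => //; first exact: measurableT_comp.
  by under eq_fun do rewrite real_normK ?num_real//.
have dom w : `|g (W w) * X w| <= K * (u (W w) * `|X w|).
  by rewrite normrM mulrA ler_wpM2r.
apply: (@le_trans _ _ (K * E (fun w => u (W w) * `|X w|))).
  rewrite -expect_scale//; apply: expect_abs_le => //.
  - apply: dominated_integrable _ dom _; last exact: integrable_scale.
    by apply: measurable_funM => //; exact: measurableT_comp.
  - exact: integrable_scale.
rewrite -mulrA ler_wpM2l// mulrC.
by apply: expect_abs_mul_le.
Qed.

Local Notation g := (clamp z a).

Let clamp_le (x : R) : a <= 1 -> `|g x| <= 4 * a * (kap * u x).
Proof.
move=> a_le1; have [xz|zx] := ltP `|x| (`|z| - 2).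
  by rewrite (clamp_eq0 a_gt0)// normr0 !mulr_ge0// ltW.
apply: (le_trans (normr_clamp_le z a_gt0 x)).
by rewrite ler_peMr ?u_window// mulr_ge0// ltW.
Qed.

(** The concentration inequality: [E Delta^2 1(|Delta| <= a, |W - z| <= a)] is
    at most the left-hand side. *)
Let concentration : a <= 1 ->
  E (fun w => Delta w * (g (W w) - g (W' w)))
    <= 8 * a * (kap * V) * (lam + SR).
Proof.
move=> a_le1; have mg := @clamp_measurable R z a.
rewrite (exchange_antisymmetric mW mW' exch mg (normr_clamp_le z a_gt0) iDelta).
rewrite (regression mg (normr_clamp_le z a_gt0)).
have bg (X : T -> R) : L1 X -> L1 (fun w => g (W w) * X w).
  by apply: (@integrable_bounded_mul _ _ _ _ (4 * a)) => //;
    [exact: measurableT_comp|move=> w; exact: normr_clamp_le].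
have -> : E (fun w => g (W w) * (lam * psi (W w) - Rm w)) =
    lam * E (fun w => g (W w) * psi (W w)) - E (fun w => g (W w) * Rm w).
  rewrite -expect_scale; last exact: bg.
  rewrite -expect_sub //; last 2 first.
  - by apply: integrable_scale; exact: bg.
  - exact: bg.
  by apply: eq_Rintegral => w _; ring.
have K0 : 0 <= 4 * a * kap by rewrite !mulr_ge0// ltW.
have gle x : `|g x| <= 4 * a * kap * u x by rewrite -mulrA clamp_le.
have h1 : `|E (fun w => g (W w) * psi (W w))| <= 4 * a * kap * V.
  rewrite -expect_scale//; apply: expect_abs_le; first exact: bg.
    exact: integrable_scale.
  by move=> w; rewrite normrM expr2 mulrA ler_pM.
have h2 : `|E (fun w => g (W w) * Rm w)| <= 4 * a * kap * V * SR.
  exact: weighted_le.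
have -> : 8 * a * (kap * V) * (lam + SR) =
    2 * (lam * (4 * a * kap * V) + 4 * a * kap * V * SR) by ring.
rewrite ler_wpM2l//; apply: lerD.
  by rewrite ler_pM2l//; apply: le_trans h1; exact: ler_norm.
by apply: le_trans h2; rewrite -normrN; exact: ler_norm.
Qed.

(** Large jumps are charged to [tailD]; for small ones the Taylor estimate
    leaves a cubic term and the window term controlled by [clamp]. *)
Let jump_le w : a <= 1 ->
  `|df (W w) * Delta w ^+ 2 - Delta w * (f (W w) - f (W' w))|
    <= kap * (2 * (u (W w) * tailD w) + u (W' w) * tailD w
              + a ^+ 3 * u (W w) ^+ 2)
       + Delta w * (g (W w) - g (W' w)).
Proof.
move=> a_le1; have gm := clamp_monotone z a (W w) (W' w).
have ua := u0 (W w); have ub := u0 (W' w).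
have ha := a_gt0; have hk := kap_ge0.
have [Da|Da] := ltP a `|Delta w|.
  rewrite mulr1.
  have h1 := stein_dsol_le sp (W w).
  have h2 := stein_lipschitz sp (W w) (W' w).
  have s2 : `|Delta w| * `|Delta w| = Delta w ^+ 2.
    by rewrite -expr2 real_normK ?num_real.
  have h3 : `|df (W w) * Delta w ^+ 2| <= kap * u (W w) * Delta w ^+ 2.
    by rewrite normrM normrX real_normK ?num_real// ler_wpM2r ?sqr_ge0.
  have h4 : `|Delta w * (f (W w) - f (W' w))|
      <= Delta w ^+ 2 * (kap * (u (W w) + u (W' w))).
    by rewrite normrM -s2 -mulrA ler_wpM2l.
  have h5 : 0 <= kap * (a ^+ 3 * u (W w) ^+ 2).
    by rewrite !mulr_ge0// ?exprn_ge0// ltW.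
  rewrite (le_trans (ler_normB _ _))//.
  apply: (le_trans (lerD h3 h4)); rewrite -subr_ge0.
  set G := Delta w * _ in gm *.
  have -> : kap * (2 * (u (W w) * Delta w ^+ 2) + u (W' w) * Delta w ^+ 2
      + a ^+ 3 * u (W w) ^+ 2) + G - (kap * u (W w) * Delta w ^+ 2
      + Delta w ^+ 2 * (kap * (u (W w) + u (W' w)))) =
      kap * (a ^+ 3 * u (W w) ^+ 2) + G by ring.
  exact: addr_ge0.
rewrite !mulr0 add0r add0r.
have D0 := normr_ge0 (Delta w).
have tay := stein_taylor sp (le_trans Da a_le1).
have -> : df (W w) * Delta w ^+ 2 - Delta w * (f (W w) - f (W' w)) =
    - (Delta w * (f (W w) - f (W' w) - Delta w * df (W w))) by ring.
rewrite normrN normrM.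
apply: (le_trans (ler_wpM2l D0 tay)); rewrite mulrDr lerD//.
  rewrite -(real_normK (num_real (Delta w))).
  set D := `|Delta w| in Da D0 *.
  have -> : D * (kap * u (W w) ^+ 2 * D ^+ 2) = D ^+ 3 * (kap * u (W w) ^+ 2).
    by ring.
  rewrite [leRHS]mulrCA ler_wpM2r ?mulr_ge0 ?sqr_ge0//.
  by rewrite lerXn2r ?nnegrE// ltW.
rewrite mulrA -expr2 real_normK ?num_real//.
have [zw|zw] := leP `|W w - z| `|Delta w|; last by rewrite mulr0.
by rewrite mulr1 (clamp_window a_gt0)// (le_trans zw).
Qed.

Let jump_bound : a <= 1 ->
  `|E (fun w => df (W w) * Delta w ^+ 2 - Delta w * (f (W w) - f (W' w)))|
    <= kap * V * (3 * SD + a ^+ 3) + 8 * a * (kap * V) * (lam + SR).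
Proof.
move=> a_le1; have [K hK] := stein_bounded sp.
have fK x : `|f x| <= K by have [] := hK x.
have dfK x : `|df x| <= K by have [] := hK x.
have i1 : L1 (fun w => df (W w) * Delta w ^+ 2).
  by apply: (@integrable_bounded_mul _ _ _ _ K).
have mul_diff (q : R -> R) (C : R) : measurable_fun setT q ->
    (forall x, `|q x| <= C) -> L1 (fun w => Delta w * (q (W w) - q (W' w))).
  move=> mq qC.
  have -> : (fun w => Delta w * (q (W w) - q (W' w))) =
      fun w => (q (W w) - q (W' w)) * Delta w by apply/funext => w; ring.
  apply: (@integrable_bounded_mul _ _ _ _ (2 * C)) => //.
    by apply: measurable_funB; exact: measurableT_comp.
  by move=> w; rewrite (le_trans (ler_normB _ _))// mulr_natl mulr2n lerD.
have i2 := mul_diff f K (stein_measurable sp) fK.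
have i3 := mul_diff g (4 * a) (@clamp_measurable R z a)
  (normr_clamp_le z a_gt0).
have iuD : L1 (fun w => u (W w) * tailD w) by exact: integrable_mul_sqr.
have iu'D : L1 (fun w => u (W' w) * tailD w) by exact: integrable_mul_sqr.
pose X w := 2 * (u (W w) * tailD w) + u (W' w) * tailD w
              + a ^+ 3 * u (W w) ^+ 2.
have iX : L1 X.
  apply: integrable_add; last exact: integrable_scale.
  by apply: integrable_add => //; exact: integrable_scale.
have EX : E X = 2 * E (fun w => u (W w) * tailD w)
    + E (fun w => u (W' w) * tailD w) + a ^+ 3 * V.
  rewrite /X expect_add; last 2 first.
  - by apply: integrable_add => //; exact: integrable_scale.
  - exact: integrable_scale.
  rewrite expect_add // ?expect_scale //; exact: integrable_scale.
apply: (le_trans (expect_abs_le (integrable_sub i1 i2) _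
  (fun w => jump_le w a_le1))).
  by apply: integrable_add => //; exact: integrable_scale.
rewrite expect_add //; last exact: integrable_scale.
rewrite expect_scale // lerD ?concentration //.
rewrite EX -mulrA ler_wpM2l//.
have absD w : `|tailD w| = tailD w by rewrite ger0_norm.
have h1 : E (fun w => u (W w) * tailD w) <= SD * V.
  have := expect_abs_mul_le mtailD muW (fun w => u0 (W w)) iD iu V_ge1.
  by under eq_Rintegral do rewrite absD.
have h2 : E (fun w => u (W' w) * tailD w) <= SD * V.
  have V1' : 1 <= E (fun w => u (W' w) ^+ 2) by rewrite V'.
  have := expect_abs_mul_le mtailD muW' (fun w => u0 (W' w)) iD iu' V1'.
  by rewrite V'; under eq_Rintegral do rewrite absD.
have -> : V * (3 * SD + a ^+ 3) = 2 * (SD * V) + SD * V + a ^+ 3 * V by ring.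
by rewrite !lerD// ler_wpM2l.
Qed.

Let small_a_bound : a <= 1 -> `|E (fun w => h (W w)) - c0|
  <= 5 * kap * V * (S1 + SR / lam + a + a ^+ 3 / lam + SD / lam).
Proof.
move=> a_le1; rewrite stein_decomposition.
have kV : 0 <= kap * V by rewrite mulr_ge0// (le_trans ler01).
have S1_0 : 0 <= S1 by exact: sqrtr_ge0.
have SR_0 : 0 <= SR by exact: sqrtr_ge0.
have SD_0 : 0 <= SD by exact: sqrtr_ge0.
have b1 : `|E (fun w => df (W w) * (1 - (2 * lam)^-1 * c w))| <= kap * V * S1.
  apply: weighted_le => //.
  - exact: stein_dmeasurable sp.
  - exact: stein_dsol_le sp.
  - by apply: measurable_funB => //; exact: measurable_funM.
have b2 : `|E (fun w => f (W w) * Rm w)| <= kap * V * SR.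
  apply: weighted_le => //; first exact: stein_measurable sp.
  exact: stein_sol_le sp.
have b3 := jump_bound a_le1.
have l0 : 0 <= lam^-1 by rewrite invr_ge0 ltW.
have l20 : 0 <= (2 * lam)^-1 by rewrite invr_ge0 mulr_ge0// ltW.
apply: le_trans (ler_normD _ _) _.
apply: (@le_trans _ _ (kap * V * S1 + lam^-1 * (kap * V * SR)
    + (2 * lam)^-1 * (kap * V * (3 * SD + a ^+ 3)
      + 8 * a * (kap * V) * (lam + SR)))).
  rewrite lerD//.
    rewrite (le_trans (ler_normB _ _))// lerD//.
    by rewrite normrM (ger0_norm l0) ler_wpM2l.
  by rewrite normrM (ger0_norm l20) ler_wpM2l.
have -> : kap * V * S1 + lam^-1 * (kap * V * SR)
    + (2 * lam)^-1 * (kap * V * (3 * SD + a ^+ 3)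
      + 8 * a * (kap * V) * (lam + SR))
  = kap * V * (S1 + (1 + 4 * a) * (SR / lam) + 4 * a
      + 2^-1 * (a ^+ 3 / lam) + 3 / 2 * (SD / lam)).
  by field; rewrite gt_eqF.
rewrite [leRHS](_ : _ = kap * V * (5 * (S1 + SR / lam + a + a ^+ 3 / lam
    + SD / lam))); last by ring.
rewrite ler_wpM2l//.
have q1 : 0 <= SR / lam by rewrite divr_ge0// ltW.
have q2 : 0 <= SD / lam by rewrite divr_ge0// ltW.
have q3 : 0 <= a ^+ 3 / lam by rewrite divr_ge0 ?exprn_ge0// ltW.
have q4 : a * (SR / lam) <= SR / lam by rewrite ler_piMl.
move: q1 q2 q3 q4 S1_0 a_gt0.
move: (SR / lam) (SD / lam) (a ^+ 3 / lam) S1 => r1 r2 r3 r4 *; lra.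
Qed.

Lemma nonuniform_bound : `|E (fun w => h (W w)) - c0|
  <= 5 * kap * V * (S1 + SR / lam + a + a ^+ 3 / lam + SD / lam).
Proof.
have [a_le1|/ltW a_ge1] := leP a 1; first exact: small_a_bound.
apply: (le_trans trivial_bound).
have kV : 0 <= kap * V by rewrite mulr_ge0// (le_trans ler01).
have q0 : 0 <= S1 by exact: sqrtr_ge0.
have q1 : 0 <= SR / lam by rewrite divr_ge0 ?sqrtr_ge0// ltW.
have q2 : 0 <= SD / lam by rewrite divr_ge0 ?sqrtr_ge0// ltW.
have q3 : 0 <= a ^+ 3 / lam by rewrite divr_ge0 ?exprn_ge0// ltW.
rewrite -[leLHS]mulr1 [leRHS](_ : _ = kap * V * (5 * (S1 + SR / lam + a
    + a ^+ 3 / lam + SD / lam))); last by ring.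
rewrite ler_wpM2l//.
move: q0 q1 q2 q3 a_ge1.
move: (SR / lam) (SD / lam) (a ^+ 3 / lam) S1 => r1 r2 r3 r4 *; lra.
Qed.

End nonuniform_bound.

(** * Conditional expectations *)

(** Rounding [y] down to a multiple of [eps], written as a sum of indicators. *)
Lemma layer_sum_dist (R : realType) (eps y : R) (N : nat) :
  0 <= eps -> 0 <= y -> y <= N%:R * eps ->
  0 <= y - \sum_(i < N) eps * (i.+1%:R * eps <= y)%R%:R <= eps.
Proof.
move=> e0 y0.
suff : (N%:R * eps <= y ->
      \sum_(i < N) eps * (i.+1%:R * eps <= y)%R%:R = N%:R * eps) /\
    (y < N%:R * eps ->
      0 <= y - \sum_(i < N) eps * (i.+1%:R * eps <= y)%R%:R <= eps).
  move=> [h1 h2]; rewrite le_eqVlt => /predU1P[yE|]; last exact: h2.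
  by rewrite h1 -yE// subrr lexx.
elim: N => [|N [IH1 IH2]].
  by rewrite big_ord0 mul0r subr0; split=> // /(le_lt_trans y0); rewrite ltxx.
rewrite big_ord_recr /= -[N.+1]addn1 natrD mulrDl mul1r.
split=> hy.
  by rewrite IH1 ?hy ?mulr1//; lra.
have -> : (N%:R * eps + eps <= y) = false by rewrite leNgt hy.
rewrite mulr0 addr0; have [yN|yN] := leP (N%:R * eps) y; last exact: IH2.
by rewrite IH1//; apply/andP; split; lra.
Qed.

Section conditional_expectation.
Context {R : realType} d {T : measurableType d} (P : probability T R).

Local Notation L1 X := (P.-integrable setT (EFin \o X)).
Local Notation E X := (Rintegral P setT X).

(** A random variable orthogonal to all indicators of [W] is orthogonal to all
    bounded functions of [W], by approximating the latter by step functions. *)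
Lemma orthogonal_bounded (W D : T -> R) (g : R -> R) (K : R) :
  measurable_fun setT W -> L1 D ->
  (forall A, measurable A -> E (fun w => D w * \1_A (W w)) = 0) ->
  measurable_fun setT g -> (forall x, `|g x| <= K) ->
  E (fun w => g (W w) * D w) = 0.
Proof.
move=> mW iD orth mg gK.
have K0 : 0 <= K by apply: le_trans (gK 0).
have ED : E D = 0.
  have := orth setT measurableT.
  by under eq_Rintegral do rewrite indicT mulr1.
(* [g'] takes values in the interval from [0] to [2 K] *)
pose g' x := g x + K.
have g'0 x : 0 <= g' x by have := gK x; rewrite ler_norml /g'; lra.
have g'K x : g' x <= 2 * K by have := gK x; rewrite ler_norml /g'; lra.
have mg' : measurable_fun setT g' by exact: measurable_funD.
pose S eps N w := \sum_(i < N) eps * (i.+1%:R * eps <= g' (W w))%R%:R.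
have iS eps N : L1 (fun w => D w * S eps N w) /\
    E (fun w => D w * S eps N w) = 0.
  elim: N => [|N [iN eN]].
    have -> : (fun w => D w * S eps 0 w) = fun=> 0.
      by apply/funext => w; rewrite /S big_ord0 mulr0.
    by split; [exact: integrable_const|rewrite expect_const].
  pose A := [set x | N.+1%:R * eps <= g' x].
  have mA : measurable A.
    rewrite -[A]setTI; apply: measurable_fun_ler => //; exact: measurable_cst.
  have iA : L1 (fun w => D w * \1_A (W w)).
    have -> : (fun w => D w * \1_A (W w)) = fun w => \1_A (W w) * D w.
      by apply/funext => w; rewrite mulrC.
    apply: (@integrable_bounded_mul _ _ _ _ 1) => //.
      by apply: measurableT_comp.
    by move=> w; rewrite indicE ger0_norm// lern1 leq_b1.
  have SE : (fun w => D w * S eps N.+1 w) =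
      fun w => D w * S eps N w + eps * (D w * \1_A (W w)).
    apply/funext => w; rewrite /S big_ord_recr /= mulrDr; congr (_ + _).
    rewrite [RHS]mulrCA indicE.
    by have -> : (W w \in A) = (N.+1%:R * eps <= g' (W w))
      by apply/idP/idP; rewrite inE.
  rewrite SE; split.
    by apply: integrable_add => //; exact: integrable_scale.
  rewrite expect_add ?expect_scale// ?orth// ?eN ?mulr0 ?addr0//.
  exact: integrable_scale.
have ig : L1 (fun w => g' (W w) * D w).
  apply: (@integrable_bounded_mul _ _ _ _ (2 * K)) => //.
    exact: measurableT_comp.
  by move=> w; rewrite ger0_norm.
have Eg : E (fun w => g' (W w) * D w) = 0.
  set e := E _; apply/eqP; rewrite -normr_le0 leNgt; apply/negP => e0.
  set M := E (fun w => `|D w|).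
  have M0 : 0 <= M by apply: Rintegral_ge0.
  (* a rounding step so fine that the error is below [|e| / 2] *)
  pose eps := `|e| / (2 * (M + 1)).
  have eps0 : 0 < eps by rewrite divr_gt0// mulr_gt0//; lra.
  pose N := (Num.truncn (2 * K / eps)).+1.
  have hN : 2 * K <= N%:R * eps.
    rewrite -ler_pdivrMr// ltW// /N.
    exact: truncnS_gt.
  have [iN eN] := iS eps N.
  have : `|e| <= eps * M.
    rewrite /M -expect_scale; last exact: integrable_abs.
    have -> : e = E (fun w => g' (W w) * D w - D w * S eps N w).
      by rewrite expect_sub// eN subr0.
    apply: expect_abs_le; first exact: integrable_sub.
      by apply: integrable_scale; exact: integrable_abs.
    move=> w; rewrite (mulrC (D w)) -mulrBl normrM ler_wpM2r//.
    have /andP[h1 h2] := @layer_sum_dist R eps (g' (W w)) N (ltW eps0) (g'0 _)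
      (le_trans (g'K _) hN).
    by rewrite ger0_norm.
  have -> : eps * M = `|e| * (M / (2 * (M + 1))) by rewrite /eps; field; lra.
  apply/negP; rewrite -ltNge -[ltRHS]mulr1 ltr_pM2l// ltr_pdivrMr; lra.
have -> : (fun w => g (W w) * D w) = fun w => g' (W w) * D w - K * D w.
  by apply/funext => w; rewrite /g'; ring.
rewrite expect_sub// ?expect_scale// ?Eg ?ED ?mulr0 ?subr0//.
exact: integrable_scale.
Qed.

Lemma cond_expectation_measurable (W : {RV P >-> R}) (X : T -> R)
    (C : T -> \bar R) :
  is_cond_expectation W X C -> measurable_fun setT C.
Proof.
move=> [_ _ mC _] _ Y mY; have [B mB BE] := mC measurableT Y mY.
rewrite -BE setTI -[X in measurable X]setTI.
exact: measurable_funP.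
Qed.

(** The integrals of [C] over [C >= 0] and over its complement are those of [X],
    hence finite. *)
Lemma cond_expectation_integrable (W : {RV P >-> R}) (X : T -> R)
    (C : T -> \bar R) :
  L1 X -> is_cond_expectation W X C -> P.-integrable setT C.
Proof.
move=> iX hC; have mC := cond_expectation_measurable hC.
case: hC => _ _ sC avg.
have mW : measurable_fun setT W by exact: measurable_funP.
have mWB B : measurable B -> measurable (W @^-1` B).
  by move=> mB; rewrite -[X in measurable X]setTI; exact: mW.
have fin B : measurable B -> (\int[P]_(w in W @^-1` B) C w)%E \is a fin_num.
  move=> mB; rewrite avg//; apply: integrable_fin_num; first exact: mWB.
  by apply: integrableS iX => //; exact: mWB.
(* the event [C >= 0] is determined by [W] *)
have m0 : measurable [set y : \bar R | (0 <= y)%E].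
  rewrite -[X in measurable X]setTI.
  by apply: emeasurable_fun_le => //; exact: measurable_cst.
have [B mB] := sC measurableT _ m0; rewrite !setTI => BE.
have inB w : B (W w) <-> (0 <= C w)%E.
  by rewrite -[B (W w)]/((W @^-1` B) w) BE.
have pos : (\int[P]_w C^\+ w < +oo)%E.
  have -> : (\int[P]_w C^\+ w = \int[P]_(w in W @^-1` B) C w)%E.
    rewrite [RHS]integral_mkcond; apply: eq_integral => w _.
    rewrite funeposE patchE; case: ifPn => [|]; rewrite ?inE ?notin_setE.
      by move=> /inB h; apply/max_idPl.
    move=> h; apply/max_idPr; rewrite leNgt; apply/negP => /ltW /inB h'.
    exact: h.
  by have := fin _ mB; rewrite fin_numE => /andP[_]; rewrite ltey.
have neg : (\int[P]_w C^\- w < +oo)%E.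
  have mBC : measurable (~` B) by exact: measurableC.
  have -> : (\int[P]_w C^\- w = \int[P]_(w in W @^-1` (~` B)) C^\- w)%E.
    rewrite [RHS]integral_mkcond; apply: eq_integral => w _.
    rewrite patchE; case: ifPn => //; rewrite notin_setE /= => /contrapT /inB h.
    by rewrite funenegE; apply/max_idPr; rewrite leeNl oppe0.
  have := fin _ mBC; rewrite integralE.
  rewrite [X in (X - _)%E](_ : _ = 0%E); last first.
    apply: integral0_eq => w hw; rewrite funeposE; apply/max_idPr.
    by rewrite leNgt; apply/negP => /ltW /inB.
  by rewrite sub0e fin_numN fin_numE => /andP[_]; rewrite ltey.
apply/integrableP; split => //.
under eq_integral do rewrite -[(`|_|)%E]/((abse \o C) _) fune_abse.
rewrite ge0_integralD //; first exact: lte_add_pinfty.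
- exact: measurable_funepos.
- exact: measurable_funeneg.
Qed.

Lemma cond_expectation_pull_out (W : {RV P >-> R}) (X : T -> R)
    (C : T -> \bar R) (g : R -> R) (K : R) :
  L1 X -> is_cond_expectation W X C ->
  measurable_fun setT g -> (forall x, `|g x| <= K) ->
  E (fun w => g (W w) * X w) = E (fun w => g (W w) * fine (C w)).
Proof.
move=> iX hC mg gK; have mW : measurable_fun setT W by exact: measurable_funP.
have iC := cond_expectation_integrable iX hC.
have mC := cond_expectation_measurable hC.
have finC : {ae P, forall w, C w \is a fin_num}.
  by have := integrable_ae measurableT iC; apply: filterS => w; apply.
have mc : measurable_fun setT (fun w => fine (C w)).
  exact: measurableT_comp.
have ic : L1 (fun w => fine (C w)).
  apply: le_integrable iC => //; first exact/measurable_EFinP.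
  by move=> w _ /=; case: (C w) => [r| |] //=; rewrite leey.
have iXc : L1 (fun w => X w - fine (C w)) by exact: integrable_sub.
have iind A : measurable A -> measurable_fun setT (fun w => \1_A (W w) : R).
  by move=> mA; exact: measurableT_comp.
have iXA (Y : T -> R) A : L1 Y -> measurable A ->
    L1 (fun w => \1_A (W w) * Y w).
  move=> iY mA; apply: (@integrable_bounded_mul _ _ _ _ 1) => //.
    exact: iind.
  by move=> w; rewrite indicE ger0_norm// lern1 leq_b1.
have restr (Y : T -> R) A : measurable A ->
    E (fun w => \1_A (W w) * Y w) = Rintegral P (W @^-1` A) Y.
  move=> mA; rewrite [RHS]Rintegral_mkcond; apply: eq_Rintegral => w _.
  rewrite patchE indicE; have -> : (w \in W @^-1` A) = (W w \in A).
    by apply/idP/idP; rewrite !inE.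
  by case: ifP => _; rewrite ?mul1r ?mul0r.
have orth A : measurable A ->
    E (fun w => (X w - fine (C w)) * \1_A (W w)) = 0.
  move=> mA.
  have -> : (fun w => (X w - fine (C w)) * \1_A (W w)) =
      fun w => \1_A (W w) * X w - \1_A (W w) * fine (C w).
    by apply/funext => w; ring.
  rewrite expect_sub ?restr//; [|exact: iXA|exact: iXA].
  apply/eqP; rewrite subr_eq0; apply/eqP; congr fine.
  have [_ _ _ avg] := hC; rewrite -avg//.
  have mWA : measurable (W @^-1` A).
    by rewrite -[X in measurable X]setTI; exact: mW.
  apply: ae_eq_integral => //.
  - exact: measurable_funTS.
  - by apply/measurable_EFinP; exact: measurable_funTS.
  - by apply: filterS finC => w h _; rewrite fineK.
have := orthogonal_bounded mW iXc orth mg gK.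
have bg (Y : T -> R) : L1 Y -> L1 (fun w => g (W w) * Y w).
  by apply: (@integrable_bounded_mul _ _ _ _ K) => //; exact: measurableT_comp.
have -> : (fun w => g (W w) * (X w - fine (C w))) =
    fun w => g (W w) * X w - g (W w) * fine (C w).
  by apply/funext => w; ring.
by rewrite expect_sub ?bg// => /eqP; rewrite subr_eq0 => /eqP.
Qed.

End conditional_expectation.

(** * The distribution function of the target law *)

Section density_cdf.
Context {R : realType} d {T : measurableType d} (Q : probability T R).
Variables (Y : {RV Q >-> R}) (k : nat) (ak : R).
Hypotheses (hk : (0 < k)%N) (hY : has_density Y (p_ k ak)).

Local Notation b := (b_ k ak).
Local Notation F := (fun z : R => fine (cdf Y z)).
Local Notation leb := (@lebesgue_measure R).

Lemma p_E (x : R) : p_ k ak x = b * weight k ak x.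
Proof. by []. Qed.

Lemma b_ge0 : 0 <= b.
Proof. by rewrite invr_ge0; apply: Rintegral_ge0 => x _; exact: expR_ge0. Qed.

Lemma density_mass1 : (\int[leb]_x (p_ k ak x)%:E = 1)%E.
Proof. by rewrite -hY// probability_setT. Qed.

(** Were the weight not integrable, [b_] would be zero by the convention on
    inverses, and [p_] could not be a density. *)
Lemma b_gt0 : 0 < b.
Proof.
rewrite lt_neqAle b_ge0 andbT; apply/negP => /eqP b0.
have := density_mass1; under eq_integral do rewrite p_E -b0 mul0r.
by rewrite integral0 => /eqP; rewrite eqe eq_sym oner_eq0.
Qed.

Lemma density_continuous : continuous (p_ k ak : R -> R).
Proof.
move=> x; apply: differentiable_continuous; apply/derivable1_diffP.
by have [] := is_derive_scale b (is_derive_weight k ak x).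
Qed.

Lemma density_integrable : leb.-integrable setT (EFin \o p_ k ak).
Proof.
apply/integrableP; split.
  apply/measurable_EFinP; apply: continuous_measurable_fun.
  exact: density_continuous.
have := density_mass1; under [X in (X < _)%E]eq_integral => x _.
  rewrite /= ger0_norm; last by rewrite p_E mulr_ge0 ?b_ge0// ltW// weight_gt0.
  over.
by move=> ->; rewrite ltry.
Qed.

Lemma cdf_fin_num (z : R) : cdf Y z \is a fin_num.
Proof. exact: fin_num_measure. Qed.

Lemma cdf_ge0_le1 (z : R) : 0 <= F z <= 1.
Proof.
rewrite fine_ge0//= -lee_fin fineK ?cdf_fin_num//.
exact: cdf_le1.
Qed.

Lemma is_derive_cdf (x : R) : is_derive x (1 : R) F (b * weight k ak x).
Proof.
have FE : F = fun z => Rintegral leb `]-oo, z] (p_ k ak).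
  by apply/funext => z; rewrite /cdf hY.
have x1 : x < x + 1 by rewrite ltrDl.
have iu : leb.-integrable `]-oo, x + 1] (EFin \o p_ k ak).
  by apply: integrableS density_integrable.
have h := @continuous_FTC1 R (p_ k ak) -oo%O x (x + 1) x1 iu.
have [|dF eF] := h _ (@density_continuous x); first by rewrite ?ltNyr.
by rewrite FE -p_E -eF derive1E; exact: derivableP.
Qed.

Lemma cdf_tails (eps : R) : 0 < eps ->
  exists t0, forall t, t0 <= t -> 1 - F t <= eps /\ F (- t) <= eps.
Proof.
move=> e0.
have h1 : F t @[t --> +oo] --> (1 : R) by exact/fine_cvg/cvg_cdfy1.
have h2 : F t @[t --> -oo] --> (0 : R) by exact/fine_cvg/cvg_cdfNy0.
have /cvgrPdist_le /(_ eps e0) [t1 [t1r ht1]] := h1.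
have /cvgrPdist_le /(_ eps e0) [t2 [t2r ht2]] := h2.
exists (Num.max (t1 + 1) (1 - t2)) => t; rewrite ge_max => /andP[a1 a2].
split.
  apply: le_trans (ler_norm _) _; apply: ht1; lra.
rewrite (le_trans (ler_norm _))// -normrN -sub0r; apply: ht2; lra.
Qed.

(** [F x + F (- x)] has derivative zero and tends to one at infinity. *)
Lemma cdf_symmetric (x : R) : F (- x) = 1 - F x.
Proof.
pose S t := F t + F (- t).
have dS (t : R) : is_derive t (1 : R) S 0.
  apply: (is_derive_eq (is_derive_add (is_derive_cdf t)
    (is_derive_reflect (is_derive_cdf (- t))))).
  by rewrite weightN subrr.
have S1 : S x = 1.
  apply/eqP; rewrite -subr_eq0 -normr_le0; apply/ler_addgt0Pr => eps e0.
  have [t0 ht0] := cdf_tails e0; have [h1 h2] := ht0 t0 (lexx _).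
  rewrite add0r (is_derive_0_is_cst x t0 dS) /S ler_norml.
  have /andP[g1 g2] := cdf_ge0_le1 t0; have /andP[g3 g4] := cdf_ge0_le1 (- t0).
  by apply/andP; split; lra.
by rewrite -S1 /S; ring.
Qed.

End density_cdf.

(** * The theorem *)

(** If one of the moments is infinite, so is the right-hand side; only finite
    moments have to be treated. *)
Lemma ereal_bound_of_finite (R : realType) (x Bp pp kap li a a3 : R)
    (m X1 X2 X3 : \bar R) :
  0 < Bp -> 0 < pp -> 0 < kap -> 0 < li -> 0 < a -> 0 <= a3 ->
  (0 <= m)%E -> (0 <= X1)%E -> (0 <= X2)%E -> (0 <= X3)%E ->
  (forall m' x1 x2 x3 : R, m = m'%:E -> X1 = x1%:E -> X2 = x2%:E ->
    X3 = x3%:E ->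
    x <= Bp * (pp + m') * kap
         * (Num.sqrt x1 + Num.sqrt x2 * li + a + a3 + Num.sqrt x3 * li)) ->
  (x%:E <= Bp%:E * (pp%:E + m) * kap%:E
    * (sqrte X1 + sqrte X2 * li%:E + a%:E + a3%:E + sqrte X3 * li%:E))%E.
Proof.
move=> Bp0 pp0 kap0 li0 a0 a30 m0 X10 X20 X30 fin_case.
pose S := (sqrte X1 + sqrte X2 * li%:E + a%:E + a3%:E + sqrte X3 * li%:E)%E.
have h1 := sqrte_ge0 X1.
have h2 : (0 <= sqrte X2 * li%:E)%E.
  by rewrite mule_ge0 ?sqrte_ge0 ?lee_fin ?ltW.
have h3 : (0 <= sqrte X3 * li%:E)%E.
  by rewrite mule_ge0 ?sqrte_ge0 ?lee_fin ?ltW.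
have ha : (0 <= a%:E)%E by rewrite lee_fin ltW.
have ha3 : (0 <= a3%:E)%E by rewrite lee_fin.
have S5 : (sqrte X3 * li%:E <= S)%E by rewrite /S leeDr// !adde_ge0.
have S4 : (sqrte X1 + sqrte X2 * li%:E + a%:E <= S)%E.
  by rewrite /S -[leRHS]addeA leeDl// adde_ge0.
have Sa : (a%:E <= S)%E by apply: le_trans S4; rewrite leeDr// adde_ge0.
have S2 : (sqrte X2 * li%:E <= S)%E.
  by apply: le_trans S4; rewrite -addeA addeCA leeDl// adde_ge0.
have S1 : (sqrte X1 <= S)%E.
  by apply: le_trans S4; rewrite -addeA leeDl// adde_ge0.
have S0 : (0 < S)%E by apply: lt_le_trans Sa; rewrite lte_fin.
have li0' : (0 < li%:E)%E by rewrite lte_fin.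
have ppm : (0 < pp%:E + m)%E.
  by apply: (@lt_le_trans _ _ pp%:E); rewrite ?lte_fin// leeDl.
have pre : (0 < Bp%:E * (pp%:E + m) * kap%:E)%E by rewrite !mule_gt0 ?lte_fin.
have infinite : S = +oo%E ->
    (x%:E <= Bp%:E * (pp%:E + m) * kap%:E * S)%E.
  by move=> ->; rewrite gt0_muley ?leey.
rewrite -/S.
case: m m0 ppm pre infinite fin_case => [m'| |]// m0 ppm pre infinite fin_case;
    last first.
  rewrite addey// gt0_muley ?lte_fin// gt0_mulye ?lte_fin// gt0_mulye//.
  exact: leey.
case: X1 X10 @S h1 S5 S4 Sa S2 S1 S0 infinite fin_case => [x1| |]// X10 S h1
    S5 S4 Sa S2 S1 S0 infinite fin_case; last first.
  by apply: infinite; apply/eqP; rewrite -leye_eq.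
case: X2 X20 @S h2 S5 S4 Sa S2 S1 S0 infinite fin_case => [x2| |]// X20 S h2
    S5 S4 Sa S2 S1 S0 infinite fin_case; last first.
  by apply: infinite; apply/eqP; rewrite -leye_eq -[leLHS](gt0_mulye li0').
case: X3 X30 @S h3 S5 S4 Sa S2 S1 S0 infinite fin_case => [x3| |]// X30 S h3
    S5 S4 Sa S2 S1 S0 infinite fin_case; last first.
  by apply: infinite; apply/eqP; rewrite -leye_eq -[leLHS](gt0_mulye li0').
rewrite /S /= lee_fin.
exact: fin_case.
Qed.

Section finite_case.
Context {R : realType}.
Variables (k : nat) (ak : R).
Hypotheses (hk : (0 < k)%N) (hak : 0 < ak).

Local Notation b := (b_ k ak).
Local Notation C := (stein_const k ak b).

(** The constant [B]; the summand [1] makes it positive without any assumption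
    on [C]. *)
Definition bound_const : R := 5 * (2 * C) ^+ 2 + 1.

Lemma bound_const_gt0 : 0 < bound_const.
Proof. by rewrite ltr_wpDl// mulr_ge0// sqr_ge0. Qed.

Variables (p q : R).
Hypotheses (p_ge : 2 * k%:R - 1 <= p) (q_ge1 : (1 : R) <= q)
  (pq : q ^+ (2 * k) = p) (C_ge0 : 0 <= C).

Local Notation u := (envelope C q p).

Lemma envelope_measurable : measurable_fun setT u.
Proof.
rewrite /envelope; apply: (measurableT_comp (measurable_powR p)).
apply: measurable_funM; first exact: measurable_cst.
by apply: measurable_funD; [exact: normr_measurable|exact: measurable_cst].
Qed.

Let p_ge1 : 1 <= p.
Proof. exact: exponent_ge1 hk p_ge. Qed.

(** [|x| + q] is at most twice the larger of its two terms. *)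
Lemma envelope_sqr_le (x : R) :
  u x ^+ 2 <= (2 * C) `^ (2 * p) * (q `^ (2 * p) + `|x| `^ (2 * p)).
Proof.
have q0 : 0 <= q by rewrite (le_trans ler01).
have y0 : 0 <= C * (`|x| + q) by rewrite mulr_ge0 ?addr_ge0.
have p2 : 0 <= 2 * p by rewrite mulr_ge0// (le_trans ler01 p_ge1).
rewrite /envelope -powR_mulrn ?powR_ge0// -powRrM (mulrC p).
have bnd (t : R) : 0 <= t -> `|x| + q <= 2 * t ->
    (C * (`|x| + q)) `^ (2 * p) <= (2 * C) `^ (2 * p) * t `^ (2 * p).
  move=> t0 xt; have C20 : 0 <= 2 * C by rewrite mulr_ge0.
  rewrite -powRM//.
  have Ct0 : 0 <= 2 * C * t by rewrite mulr_ge0.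
  have le : C * (`|x| + q) <= 2 * C * t.
    apply: (@le_trans _ _ (C * (2 * t))); last by rewrite mulrA (mulrC C).
    exact: ler_wpM2l.
  by apply: ge0_ler_powR; rewrite ?nnegrE.
have [xq|qx] := leP `|x| q.
  apply: (le_trans (bnd q q0 _)); first by lra.
  by rewrite ler_wpM2l ?powR_ge0// lerDl powR_ge0.
apply: (le_trans (bnd `|x| (normr_ge0 x) _)); first by lra.
by rewrite ler_wpM2l ?powR_ge0// lerDr powR_ge0.
Qed.

Lemma bound_const_powR : 5 * (2 * C) `^ (2 * p) <= bound_const `^ p.
Proof.
have C2 : 0 <= 2 * C by rewrite mulr_ge0.
apply: (@le_trans _ _ ((5 * (2 * C) ^+ 2) `^ p)); last first.
  apply: ge0_ler_powR; rewrite ?nnegrE ?(le_trans ler01 p_ge1)//.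
  - by rewrite mulr_ge0// sqr_ge0.
  - by rewrite ltW// bound_const_gt0.
  - by rewrite lerDl.
rewrite powRrM powR_mulrn//; apply: scale_powR => //; rewrite ?sqr_ge0//.
by rewrite ler1n.
Qed.

Lemma envelope_moment d (T : measurableType d) (P : probability T R)
    (W : T -> R) : measurable_fun setT W ->
  P.-integrable setT (EFin \o (fun w => `|W w| `^ (2 * p))) ->
  P.-integrable setT (EFin \o (fun w => u (W w) ^+ 2)) /\
  5 * Rintegral P setT (fun w => u (W w) ^+ 2) <=
    bound_const `^ p * (q `^ (2 * p)
      + Rintegral P setT (fun w => `|W w| `^ (2 * p))).
Proof.
move=> mW im.
have iB : P.-integrable setT (EFin \o (fun w =>
    (2 * C) `^ (2 * p) * (q `^ (2 * p) + `|W w| `^ (2 * p)))).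
  apply: integrable_scale; apply: integrable_add => //.
  exact: integrable_const.
have iu : P.-integrable setT (EFin \o (fun w => u (W w) ^+ 2)).
  apply: dominated_integrable _ _ iB.
    apply: measurable_funX; apply: measurableT_comp => //.
    exact: envelope_measurable.
  by move=> w; rewrite ger0_norm ?sqr_ge0// envelope_sqr_le.
split=> //.
have := expect_le iu iB (fun w => envelope_sqr_le (W w)).
rewrite expect_scale; last first.
  by apply: integrable_add => //; exact: integrable_const.
rewrite expect_add //; last exact: integrable_const.
rewrite expect_const => h.
set m := Rintegral P setT (fun w => `|W w| `^ (2 * p)) in h *.
apply: (@le_trans _ _ (5 * ((2 * C) `^ (2 * p) * (q `^ (2 * p) + m)))).
  by rewrite ler_wpM2l.
rewrite mulrA ler_wpM2r ?bound_const_powR// addr_ge0 ?powR_ge0//.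
by apply: Rintegral_ge0 => w _; exact: powR_ge0.
Qed.

End finite_case.

Lemma cdf_expect (R : realType) d (T : measurableType d) (P : probability T R)
    (W : {RV P >-> R}) (z : R) :
  cdf W z = (Rintegral P setT (fun w => (W w <= z)%R%:R))%:E.
Proof.
have mW : measurable_fun setT W by exact: measurable_funP.
have mA : measurable (W @^-1` `]-oo, z]).
  by rewrite -[X in measurable X]setTI; exact: mW.
have -> : (fun w => (W w <= z)%R%:R) = \1_(W @^-1` `]-oo, z]) :> (T -> R).
  apply/funext => w; rewrite indicE.
  by have -> : (w \in W @^-1` `]-oo, z]) = (W w <= z)%R
    by apply/idP/idP; rewrite inE /= in_itv.
rewrite /Rintegral integral_indic// setIT fineK//.
exact: fin_num_measure.
Qed.

Theorem theorem2p3 (R : realType) (k : nat) (ak : R) (hk : (0 < k)%N)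
    (hak : 0 < ak) :
  exists B : R, 0 < B /\
    forall (d' : measure_display) (T' : measurableType d')
      (Q : probability T' R) (Y : {RV Q >-> R}),
      has_density Y (p_ k ak) ->
    forall (d : measure_display) (T : measurableType d) (P : probability T R)
      (W W' Rem : {RV P >-> R}) (lambda : R),
      exchangeable W W' ->
      0 < lambda -> lambda < 1 ->
    forall EW' : T -> \bar R,
      is_cond_expectation W W' EW' ->
      {ae P, forall w,
        EW' w = (W w - lambda * psi k ak (W w) + Rem w)%:E} ->
    let Delta := fun w : T => W w - W' w in
    forall EDelta2 : T -> \bar R,
      is_cond_expectation W (fun w => Delta w ^+ 2) EDelta2 ->
    forall a p z : R,
      0 < a -> 2 * k%:R - 1 <= p ->
      (`| cdf W z - cdf Y z | <=
        (B `^ p)%:E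
        * ((p `^ (p / k%:R))%:E
           + 'E_P[fun w : T => (`|W w| `^ (2 * p))%R])
        * (((1 + `|z|) `^ p)^-1)%:E
        * (sqrte (\int[P]_w
             (1 - ((2 * lambda)^-1)%:E * EDelta2 w) ^+ 2)
           + sqrte 'E_P[fun w : T => (Rem w ^+ 2)%R] * (lambda^-1)%:E
           + a%:E
           + (a ^+ 3 / lambda)%:E
           + sqrte 'E_P[fun w : T =>
               (Delta w ^+ 4 * \1_[set w' | (a < `|Delta w'|)%R] w)%R]
             * (lambda^-1)%:E))%E.
Proof.
exists (bound_const k ak); split; first exact: bound_const_gt0.
move=> d' T' Q Y hY d T P W W' Rem lambda exch lam0 _ EW' hEW' aeEW' Delta
  EDelta2 hED a p z a0 p_ge.
have p1 := exponent_ge1 hk p_ge.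
have p0 : 0 < p by apply: lt_le_trans p1.
have hb := b_gt0 hY.
have k0 : (k%:R : R) != 0 by rewrite pnatr_eq0 -lt0n.
have mW : measurable_fun setT W by exact: measurable_funP.
have mW' : measurable_fun setT W' by exact: measurable_funP.
have mRem : measurable_fun setT Rem by exact: measurable_funP.
have kap0 : 0 < ((1 + `|z|) `^ p)^-1.
  by rewrite invr_gt0 powR_gt0// ltr_pwDl.
(* [q] is the scale on which the exponent [p] acts: [q^(2k) = p] *)
pose q := p `^ ((2 * k)%:R^-1).
have q1 : 1 <= q by rewrite -[leLHS](powRr0 p) ler_powR// invr_ge0.
have qk : q ^+ (2 * k) = p.
  rewrite -powR_mulrn ?powR_ge0// -powRrM mulVf ?powRr1 ?ltW//.
  by rewrite natrM mulf_neq0.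
have qp : q `^ (2 * p) = p `^ (p / k%:R).
  by rewrite -powRrM natrM; congr (_ `^ _); field.
have C0 : 0 <= stein_const k ak (b_ k ak).
  apply: le_trans (stein_const_ge2A k hak hb).
  by rewrite !mulr_ge0// addr_ge0// divr_ge0// ltW.
pose F x := fine (cdf Y x).
have F01 x := cdf_ge0_le1 Y x.
have [f [df sp]] := stein_pair_exists hk hak hb p_ge q1 qk
  (is_derive_cdf hY) (fun x => (andP (F01 x)).1) (fun x => (andP (F01 x)).2)
  (cdf_symmetric hY) (fun eps e0 => let: ex_intro t0 h := cdf_tails Y e0 in
    ex_intro _ t0 (fun t ht => (h t ht).1)) z.
have Delta4E (w : T) : Delta w ^+ 4 * \1_[set w' | a < `|Delta w'|] w =
    (Delta w ^+ 2 * (a < `|Delta w|)%R%:R) ^+ 2.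
  rewrite indicE exprMn -exprM; congr (_ * _).
  have -> : (w \in [set w' | a < `|Delta w'|]) = (a < `|Delta w|)%R.
    by apply/idP/idP; rewrite inE.
  by case: (a < _); rewrite ?expr1n ?expr0n.
have -> : `|cdf W z - cdf Y z|%E =
    (`|Rintegral P setT (fun w => (W w <= z)%R%:R) - F z|)%:E.
  rewrite cdf_expect -[cdf Y z]fineK; last exact: cdf_fin_num.
  by rewrite -EFinB.
have expE (X : T -> R) : 'E_P[X]%E = (\int[P]_w (X w)%:E)%E by rewrite unlock.
rewrite !expE -qp.
(* a finite integral of a nonnegative function gives integrability *)
have finite_L1 (X : T -> R) (r : R) : measurable_fun setT X ->
    (forall w, 0 <= X w) -> (\int[P]_w (X w)%:E = r%:E)%E ->
    P.-integrable setT (EFin \o X) /\ Rintegral P setT X = r.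
  move=> mX X0 Xr; split; last by rewrite /Rintegral Xr.
  apply/integrableP; split; first exact/measurable_EFinP.
  under eq_integral do rewrite /= ger0_norm//.
  by rewrite Xr ltry.
apply: ereal_bound_of_finite.
- exact/powR_gt0/bound_const_gt0.
- by rewrite powR_gt0// (lt_le_trans ltr01).
- exact: kap0.
- by rewrite invr_gt0.
- exact: a0.
- by rewrite divr_ge0 ?exprn_ge0// ltW.
- by apply: integral_ge0 => w _; rewrite lee_fin powR_ge0.
- by apply: integral_ge0 => w _; exact: sqre_ge0.
- by apply: integral_ge0 => w _; rewrite lee_fin sqr_ge0.
- by apply: integral_ge0 => w _; rewrite lee_fin Delta4E sqr_ge0.
move=> m x1 x2 x3 em e1 e2 e3.
set C := stein_const k ak (b_ k ak) in C0 sp *; set u := envelope C q p in sp.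
have mu : measurable_fun setT u by exact: envelope_measurable.
have [im mE] := finite_L1 (fun w => `|W w| `^ (2 * p)) m
  (measurableT_comp (measurable_powR _)
    (measurableT_comp (@normr_measurable R setT) mW))
  (fun w => powR_ge0 _ _) em.
have [iu uE] := envelope_moment hk p_ge q1 C0 mW im.
have u1 := envelope_ge1 hk hak hb p_ge q1.
have uabs := normr_le_envelope hk hak hb p_ge q1.
have upsi := psi_le_envelope hk hak hb p_ge q1.
have iW := fst_integrable mW u1 uabs iu.
have iW' := snd_integrable mW mW' exch mu u1 uabs iu.
have iD2 := jump_sqr_integrable mW mW' exch mu uabs iu.
have mpsi : measurable_fun setT (psi k ak).
  exact: is_derive_measurable (is_derive_psi k ak).
have ipsi := drift_integrable mW mpsi u1 upsi iu.
have [iR RE] := finite_L1 (fun w => Rem w ^+ 2) x2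
  (measurable_funX 2 mRem) (fun w => sqr_ge0 _) e2.
have iRem : P.-integrable setT (EFin \o Rem).
  apply: (@dominated_integrable _ _ _ _ _ (fun w => 1 + Rem w ^+ 2)) => //.
    move=> w; rewrite -(real_normK (num_real (Rem w))).
    by have := normr_ge0 (Rem w); set t := `|_|; have := sqr_ge0 (t - 1); nra.
  by apply: integrable_add => //; exact: integrable_const.
have mD : measurable_fun setT Delta by exact: measurable_funB.
have mtail : measurable_fun setT
    (fun w => Delta w ^+ 2 * (a < `|Delta w|)%R%:R).
  apply: measurable_funM; first exact: measurable_funX.
  apply: measurable_natr_bool; apply: measurable_fun_ltr.
    exact: measurable_cst.
  exact: measurableT_comp.
have e3' : (\int[P]_w ((Delta w ^+ 2 * (a < `|Delta w|)%R%:R) ^+ 2)%:E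
    = x3%:E)%E.
  by rewrite -e3; apply: eq_integral => w _; rewrite Delta4E.
have [iT TE] := finite_L1 _ x3 (measurable_funX 2 mtail)
  (fun w => sqr_ge0 _) e3'.
have iED := cond_expectation_integrable iD2 hED.
have mED := cond_expectation_measurable hED.
pose c w := fine (EDelta2 w).
have mc : measurable_fun setT c by exact: measurableT_comp.
have e1' : (\int[P]_w ((1 - (2 * lambda)^-1 * c w) ^+ 2)%:E = x1%:E)%E.
  rewrite -e1; apply: ae_eq_integral => //.
  - apply/measurable_EFinP; apply: measurable_funX.
    apply: measurable_funB => //.
    exact: measurable_funM.
  - have mS : measurable_fun setT
        (fun w => (1 - ((2 * lambda)^-1)%:E * EDelta2 w)%E).
      apply: emeasurable_funB; first exact: measurable_cst.
      by apply: emeasurable_funM => //; exact: measurable_cst.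
    under eq_fun do rewrite expe2.
    exact: emeasurable_funM.
  - have := integrable_ae measurableT iED; apply: filterS => w h _.
    by rewrite -[EDelta2 w]fineK ?h// -EFinM -EFinB -EFin_expe.
have mcc : measurable_fun setT (fun w => 1 - (2 * lambda)^-1 * c w).
  by apply: measurable_funB => //; exact: measurable_funM.
have [ic CE] := finite_L1 _ x1 (measurable_funX 2 mcc) (fun w => sqr_ge0 _) e1'.
have bounded_mul (g : R -> R) (K : R) (X : T -> R) : measurable_fun setT g ->
    (forall x, `|g x| <= K) -> P.-integrable setT (EFin \o X) ->
    P.-integrable setT (EFin \o (fun w => g (W w) * X w)).
  by move=> mg gK; apply: (@integrable_bounded_mul _ _ _ _ K) => //;
    exact: measurableT_comp.
have regression (g : R -> R) (K : R) : measurable_fun setT g ->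
    (forall x, `|g x| <= K) ->
    Rintegral P setT (fun w => g (W w) * (W w - W' w)) =
    Rintegral P setT (fun w => g (W w) * (lambda * psi k ak (W w) - Rem w)).
  move=> mg gK.
  have bm := fun X => @bounded_mul g K X mg gK.
  have iS : P.-integrable setT
      (EFin \o (fun w => W w - lambda * psi k ak (W w) + Rem w)).
    apply: integrable_add => //; apply: integrable_sub => //.
    exact: integrable_scale.
  have mgW : measurable_fun setT (fun w => g (W w)) by exact: measurableT_comp.
  have ecE : Rintegral P setT (fun w => g (W w) * W' w) = Rintegral P setT
      (fun w => g (W w) * (W w - lambda * psi k ak (W w) + Rem w)).
    rewrite (cond_expectation_pull_out iW' hEW' mg gK); congr fine.
    have mEW := cond_expectation_measurable hEW'.
    apply: ae_eq_integral => //.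
    - apply/measurable_EFinP; apply: measurable_funM => //.
      exact: measurableT_comp.
    - apply/measurable_EFinP; apply: measurable_funM => //.
      exact: integrable_measurable iS.
    - by apply: filterS aeEW' => w -> _.
  have iL : P.-integrable setT
      (EFin \o (fun w => lambda * psi k ak (W w) - Rem w)).
    by apply: integrable_sub => //; exact: integrable_scale.
  have -> : Rintegral P setT (fun w => g (W w) * (W w - W' w)) =
      Rintegral P setT (fun w => g (W w) * W w)
      - Rintegral P setT (fun w => g (W w) * W' w).
    rewrite -expect_sub; [|exact: bm|exact: bm].
    by apply: eq_Rintegral => w _; ring.
  rewrite ecE -expect_sub; [|exact: bm|exact: bm].
  by apply: eq_Rintegral => w _; ring.
have variance_id (g : R -> R) (K : R) : measurable_fun setT g ->
    (forall x, `|g x| <= K) ->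
    Rintegral P setT (fun w => g (W w) * (W w - W' w) ^+ 2) =
    Rintegral P setT (fun w => g (W w) * c w).
  by move=> mg gK; exact: (cond_expectation_pull_out iD2 hED mg gK).
have mh : measurable_fun setT (fun x : R => (x <= z)%R%:R : R).
  by apply: measurable_natr_bool; apply: measurable_fun_ler.
have := nonuniform_bound mW mW' mRem mc exch mpsi mh mu sp (ltW kap0) lam0 a0
  u1 uabs upsi (fun x h => window_le_envelope hk hak hb p_ge q1 h)
  iu iR ic iT regression variance_id.
rewrite CE RE TE => h; apply: (le_trans h).
rewrite mE in uE.
rewrite [leLHS](_ : _ = 5 * Rintegral P setT (fun w => u (W w) ^+ 2)
  * (((1 + `|z|) `^ p)^-1 * (Num.sqrt x1 + Num.sqrt x2 / lambda + a
    + a ^+ 3 / lambda + Num.sqrt x3 / lambda))); last by ring.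
rewrite -[leRHS]mulrA ler_wpM2r// mulr_ge0 ?(ltW kap0)//.
have l0 : 0 <= lambda^-1 by rewrite invr_ge0 ltW.
by rewrite !addr_ge0 ?mulr_ge0 ?sqrtr_ge0 ?exprn_ge0 ?(ltW a0).
Qed.
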